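(* Let $f:\mathbb{R}^m\to\mathbb{R}$ be $C^3$ and let $\{x_n\}$ be a sequence constructed by Backtracking New Q-Newton's method (BNQN) with $0<\tau\le1$. 1) Assume $f$ satisfies the Lojasiewicz gradient inequality at each of its critical points, $f$ has at most countably many critical points, and $\nabla f$ satisfies the Lojasiewicz gradient inequality. Then either $\lim_{n\to\infty}\|x_n\|=\infty$ or $\{x_n\}$ converges to a critical point of $f$. 2) Assume $f$ satisfies the Lojasiewicz gradient inequality at each of its critical points, and that $\mu(x^* )(1+\tau)<1$ for every critical point $x^*$ of $f$; if $\tau=1$ assume moreover that $\nabla f$ satisfies the Lojasiewicz gradient inequality. Then either $\lim_{n\to\infty}\|x_n\|=\infty$ or $\{x_n\}$ converges to a critical point of $f$.
   Context: BNQN: fix $m+1$ distinct reals $\delta_0,\dots,\delta_m$, $\tau>0$, $0<\gamma_0<1$, $\kappa=\frac12\min_{i\neq j}|\delta_i-\delta_j|$; $\mathrm{minsp}(A)$ is the minimum absolute value of eigenvalues of a symmetric matrix $A$, and $pr_{A,\pm}$ the orthogonal projections onto the spans of eigenvectors with positive/negative eigenvalues. Given $x_k$: if $\nabla f(x_k)=0$ set $x_{k+1}=x_k$; otherwise let $j$ be the smallest index with $\mathrm{minsp}(\nabla^2 f(x_k)+\delta_j\|\nabla f(x_k)\|^\tau I)\ge\kappa\|\nabla f(x_k)\|^\tau$, $A_k=\nabla^2 f(x_k)+\delta_j\|\nabla f(x_k)\|^\tau I$, $v_k=A_k^{-1}\nabla f(x_k)$, $w_k=pr_{A_k,+}v_k-pr_{A_k,-}v_k$,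 $\widehat{w_k}=w_k/\max\{1,\|w_k\|\}$, $\gamma_k$ the largest $\gamma\in\{\gamma_03^{-n}:n\ge0\}$ with $f(x_k-\gamma\widehat{w_k})-f(x_k)\le-\gamma\langle\widehat{w_k},\nabla f(x_k)\rangle/3$, and $x_{k+1}=x_k-\gamma_k\widehat{w_k}$. A $C^1$ function $g$ satisfies the Lojasiewicz gradient inequality at a point $x^*$ if there exist a neighbourhood $U$ of $x^*$, $0<\mu<1$ and $C>0$ with $|g(x)-g(x^* )|^\mu\le C\|\nabla g(x)\|$ for all $x\in U$. The Lojasiewicz exponent at a critical point $x^*$ of $f$ is $\mu(x^* ):=\inf\{\mu:$ there exist a neighbourhood $U$ of $x^*$ and $C>0$ with $|f(x)-f(x^* )|^\mu\le C\|\nabla f(x)\|$ for all $x\in U\}$. ''$\nabla f$ satisfies the Lojasiewicz gradient inequality'' means the function $F(x,y)=\langle\nabla f(x),y\rangle$ on $\mathbb{R}^{2m}$ satisfies the Lojasiewicz gradient inequality at every point of $\mathbb{R}^{2m}$. *)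

(* Defs.v *)
From HB Require Import structures.
From mathcomp Require Import all_boot all_order all_algebra.
From mathcomp Require Import all_classical all_reals all_analysis.
Set Implicit Arguments.
Unset Strict Implicit.
Unset Printing Implicit Defensive.
Import Order.TTheory GRing.Theory Num.Theory.
Import numFieldNormedType.Exports.
Local Open Scope classical_set_scope.
Local Open Scope ring_scope.

Section Defs.
Variable R : realType.

Definition dot {n} (u v : 'cV[R]_n) : R := \sum_(i < n) u i 0 * v i 0.
Definition enorm {n} (u : 'cV[R]_n) : R := Num.sqrt (dot u u).

Definition ebasis {n} (i : 'I_n) : 'cV[R]_n := delta_mx i 0.

Definition partial {n} (i : 'I_n) (g : 'cV[R]_n -> R) (x : 'cV[R]_n) : R :=
  derive1 (fun t : R => g (x + t *: ebasis i)) 0.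

Definition econt {n} (g : 'cV[R]_n -> R) : Prop :=
  forall x eps, 0 < eps -> exists2 d, 0 < d &
    forall y, enorm (y - x) < d -> `|g y - g x| < eps.

Fixpoint Ck {n} (k : nat) (g : 'cV[R]_n -> R) : Prop :=
  match k with
  | 0 => econt g
  | k'.+1 => econt g /\
      (forall i x, derivable (fun t : R => g (x + t *: ebasis i)) 0 1) /\
      (forall i, Ck k' (partial i g))
  end.

Definition grad {n} (g : 'cV[R]_n -> R) (x : 'cV[R]_n) : 'cV[R]_n :=
  \col_i partial i g x.

Definition hessian {n} (g : 'cV[R]_n -> R) (x : 'cV[R]_n) : 'M[R]_n :=
  \matrix_(i, j) partial j (partial i g) x.

Definition critical {n} (g : 'cV[R]_n -> R) (x : 'cV[R]_n) : Prop :=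
  grad g x = 0.

Definition loj_at {n} (g : 'cV[R]_n -> R) (xs : 'cV[R]_n) : Prop :=
  exists r mu C, [/\ 0 < r, 0 < mu < 1, 0 < C &
    forall x, enorm (x - xs) < r ->
      `|g x - g xs| `^ mu <= C * enorm (grad g x)].

Definition loj_exponent {n} (g : 'cV[R]_n -> R) (xs : 'cV[R]_n) : R :=
  inf [set mu : R | 0 < mu /\ exists r C, [/\ 0 < r, 0 < C &
    forall x, enorm (x - xs) < r ->
      `|g x - g xs| `^ mu <= C * enorm (grad g x)]].

Definition gradF {m} (f : 'cV[R]_m -> R) : 'cV[R]_(m + m) -> R :=
  fun z => dot (grad f (usubmx z)) (dsubmx z).

Definition grad_loj {m} (f : 'cV[R]_m -> R) : Prop :=
  forall z, loj_at (gradF f) z.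

Definition is_eigvec {n} (A : 'M[R]_n) (a : R) (v : 'cV[R]_n) : Prop :=
  v != 0 /\ A *m v = a *: v.
Definition minsp {n} (A : 'M[R]_n) : R :=
  inf [set `|a| | a in [set a : R | exists v, is_eigvec A a v]].

Definition span {n} (S : set 'cV[R]_n) : set 'cV[R]_n :=
  [set u | exists k (c : 'I_k -> R) (vs : 'I_k -> 'cV[R]_n),
     (forall i, S (vs i)) /\ u = \sum_(i < k) c i *: vs i].

Definition pos_space {n} (A : 'M[R]_n) := span [set v | exists a, 0 < a /\ is_eigvec A a v].
Definition neg_space {n} (A : 'M[R]_n) := span [set v | exists a, a < 0 /\ is_eigvec A a v].

Definition orth_proj {n} (S : set 'cV[R]_n) (v p : 'cV[R]_n) : Prop :=
  S p /\ forall s, S s -> dot (v - p) s = 0.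

Definition kappa {m} (delta : 'I_m.+1 -> R) : R :=
  (\big[Num.min/ `|delta ord0 - delta ord_max|]_(i : 'I_m.+1)
     \big[Num.min/ `|delta ord0 - delta ord_max|]_(j : 'I_m.+1 | j != i)
        `|delta i - delta j|) / 2.

Definition shiftA {m} (f : 'cV[R]_m -> R) (delta : 'I_m.+1 -> R) (tau : R)
    (x : 'cV[R]_m) (j : 'I_m.+1) : 'M[R]_m :=
  hessian f x + (delta j * enorm (grad f x) `^ tau)%:M.

Definition armijo {m} (f : 'cV[R]_m -> R) (x wh : 'cV[R]_m) (g : R) : Prop :=
  f (x - g *: wh) - f x <= - (g * dot wh (grad f x)) / 3.

Definition bnqn_step {m} (f : 'cV[R]_m -> R) (delta : 'I_m.+1 -> R)
    (tau gamma0 : R) (x y : 'cV[R]_m) : Prop :=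
  if grad f x == 0 then y = x else
  exists (j : 'I_m.+1) (p q : 'cV[R]_m) (nn : nat),
    let gn := enorm (grad f x) `^ tau in
    let A := shiftA f delta tau x j in
    let v := invmx A *m grad f x in
    let w := p - q in
    let wh := (Num.max 1 (enorm w))^-1 *: w in
    let gam := gamma0 / 3 ^+ nn in
    [/\
        kappa delta * gn <= minsp A /\
        (forall i : 'I_m.+1, (i < j)%N ->
           ~ (kappa delta * gn <= minsp (shiftA f delta tau x i))),
        orth_proj (pos_space A) v p /\ orth_proj (neg_space A) v q,
        armijo f x wh gam,
        (forall n' : nat, (n' < nn)%N -> ~ armijo f x wh (gamma0 / 3 ^+ n')) &
        y = x - gam *: wh].

Definition bnqn_seq {m} (f : 'cV[R]_m -> R) (delta : 'I_m.+1 -> R)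
    (tau gamma0 : R) (x : nat -> 'cV[R]_m) : Prop :=
  forall k, bnqn_step f delta tau gamma0 (x k) (x k.+1).

Definition diverges {m} (x : nat -> 'cV[R]_m) : Prop :=
  forall M : R, exists N, forall n, (N <= n)%N -> M < enorm (x n).

Definition converges_to {m} (x : nat -> 'cV[R]_m) (l : 'cV[R]_m) : Prop :=
  forall eps : R, 0 < eps -> exists N, forall n, (N <= n)%N -> enorm (x n - l) < eps.

End Defs.

(* Main.v *)
Require Import Defs.
From HB Require Import structures.
From mathcomp Require Import all_boot all_order all_algebra.
From mathcomp Require Import all_classical all_reals all_analysis.
From mathcomp Require Import complex ring lra.
Set Implicit Arguments.
Unset Strict Implicit.
Unset Printing Implicit Defensive.
Import Order.TTheory GRing.Theory Num.Theory.
Import numFieldNormedType.Exports.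
Local Open Scope ring_scope.

(** In an orthonormal eigenbasis of the shifted Hessian A, with eigenvalues a_i,
    the direction w has components g_i / |a_i|, where g is the gradient.  Locally
    kappa |g|^tau <= |a_i| <= B, so that <w, g> dominates both
    kappa |g|^tau |w|^2 and |g|^2 / B, hence <w, g> >= c |g|^(1 + tau/2) |w|.
    Near a noncritical point, this angle condition bounds the backtracking step
    from below, hence every cluster point is critical.

    Part 2: combining the angle condition with Armijo's inequality and
    |f - f(p)|^mu <= C |g| bounds the step lengths by a telescoping sum of
    (f(x_k) - f(p))^(1 - theta), with theta = mu (1 + tau/2) < 1.

    Part 1: the gradient inequality for F(x, e) = <grad f(x), e>, made uniform over
    the unit sphere, gives |g_i|^nu <= C (|H e_i| + |g|) <= C' |a_i| for some nu < 1,
    hence |w_i| <= C' |g|^(1 - nu): steps vanish near critical points.  If x_k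
    had a cluster point p without converging to it, it would cross infinitely
    often a sphere around p that avoids the countably many critical points;
    as steps vanish, a cluster point of the crossings would lie on it. *)

(** * Euclidean geometry and the spectral theorem *)

Lemma dotE (R : realType) n (u v : 'cV[R]_n) : dot u v = (u^T *m v) 0 0.
Proof. by rewrite mxE; apply: eq_bigr => i _; rewrite mxE. Qed.

Lemma dotC (R : realType) n (u v : 'cV[R]_n) : dot u v = dot v u.
Proof. by apply: eq_bigr => i _; rewrite mulrC. Qed.

Lemma dotDl (R : realType) n (u v w : 'cV[R]_n) : dot (u + v) w = dot u w + dot v w.
Proof. by rewrite !dotE linearD mulmxDl mxE. Qed.

Lemma dotNl (R : realType) n (u w : 'cV[R]_n) : dot (- u) w = - dot u w.
Proof. by rewrite !dotE linearN mulNmx mxE. Qed.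

Lemma dotBl (R : realType) n (u v w : 'cV[R]_n) : dot (u - v) w = dot u w - dot v w.
Proof. by rewrite dotDl dotNl. Qed.

Lemma dotZl (R : realType) n a (u w : 'cV[R]_n) : dot (a *: u) w = a * dot u w.
Proof. by rewrite !dotE linearZ -scalemxAl mxE. Qed.

Lemma dotBr (R : realType) n (u v w : 'cV[R]_n) : dot w (u - v) = dot w u - dot w v.
Proof. by rewrite dotC dotBl !(dotC _ w). Qed.

Lemma dotDr (R : realType) n (u v w : 'cV[R]_n) : dot w (u + v) = dot w u + dot w v.
Proof. by rewrite dotC dotDl !(dotC _ w). Qed.

Lemma dotZr (R : realType) n a (u w : 'cV[R]_n) : dot w (a *: u) = a * dot w u.
Proof. by rewrite dotC dotZl dotC. Qed.

Lemma dot0l (R : realType) n (w : 'cV[R]_n) : dot 0 w = 0.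
Proof. by rewrite -(scale0r 0) dotZl mul0r. Qed.

Lemma dotvv_ge0 (R : realType) n (u : 'cV[R]_n) : 0 <= dot u u.
Proof. by apply: sumr_ge0 => i _; rewrite -expr2 sqr_ge0. Qed.

Lemma dotvv_eq0 (R : realType) n (u : 'cV[R]_n) : (dot u u == 0) = (u == 0).
Proof.
apply/eqP/eqP => [/psumr_eq0P h|->]; last exact: dot0l.
apply/colP => i; rewrite mxE; apply/eqP.
by rewrite -sqrf_eq0 expr2 h// => j _; rewrite -expr2 sqr_ge0.
Qed.

Lemma dot_mulmxl (R : realType) n (A : 'M[R]_n) (u v : 'cV[R]_n) :
  dot (A *m u) v = dot u (A^T *m v).
Proof. by rewrite !dotE trmx_mul mulmxA. Qed.

Lemma enorm_ge0 (R : realType) n (u : 'cV[R]_n) : 0 <= enorm u.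
Proof. exact: sqrtr_ge0. Qed.

Lemma sqr_enorm (R : realType) n (u : 'cV[R]_n) : enorm u ^+ 2 = dot u u.
Proof. by rewrite sqr_sqrtr ?dotvv_ge0. Qed.

Lemma enorm_eq0 (R : realType) n (u : 'cV[R]_n) : (enorm u == 0) = (u == 0).
Proof. by rewrite -dotvv_eq0 -sqr_enorm sqrf_eq0. Qed.

Lemma enorm_gt0 (R : realType) n (u : 'cV[R]_n) : (0 < enorm u) = (u != 0).
Proof. by rewrite lt0r enorm_eq0 enorm_ge0 andbT. Qed.

Lemma enorm0 (R : realType) n : enorm (0 : 'cV[R]_n) = 0.
Proof. by apply/eqP; rewrite enorm_eq0. Qed.

Lemma enormZ (R : realType) n a (u : 'cV[R]_n) : enorm (a *: u) = `|a| * enorm u.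
Proof.
by rewrite /enorm dotZl dotZr mulrA -expr2 sqrtrM ?sqr_ge0// sqrtr_sqr.
Qed.

Lemma enormN (R : realType) n (u : 'cV[R]_n) : enorm (- u) = enorm u.
Proof. by rewrite -scaleN1r enormZ normrN1 mul1r. Qed.

Lemma enorm_distC (R : realType) n (u v : 'cV[R]_n) : enorm (u - v) = enorm (v - u).
Proof. by rewrite -enormN opprB. Qed.

Lemma Cauchy_Schwarz_dot (R : realType) n (u v : 'cV[R]_n) :
  `|dot u v| <= enorm u * enorm v.
Proof.
rewrite -(ler_pXn2r (_ : 0 < 2)%N) ?nnegrE ?mulr_ge0 ?enorm_ge0//.
rewrite exprMn !sqr_enorm real_normK ?num_real//.
have [->|v0] := eqVneq v 0; first by rewrite !(dotC _ 0) !dot0l expr0n mulr0.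
have v1 : 0 < dot v v by rewrite lt0r dotvv_eq0 v0 dotvv_ge0.
(* This squared norm equals [dot v v] times the difference of the two sides. *)
have := dotvv_ge0 (dot v v *: u - dot u v *: v).
rewrite !(dotBl, dotBr, dotZl, dotZr) (dotC v u) => h.
rewrite -subr_ge0 -(pmulr_rge0 _ v1); apply: le_trans h _.
by rewrite le_eqVlt; apply/orP; left; apply/eqP; ring.
Qed.

Lemma ler_enormD (R : realType) n (u v : 'cV[R]_n) : enorm (u + v) <= enorm u + enorm v.
Proof.
rewrite -(ler_pXn2r (_ : 0 < 2)%N) ?nnegrE ?addr_ge0 ?enorm_ge0//.
rewrite sqrrD !sqr_enorm !(dotDl, dotDr) (dotC v u).
have := le_trans (ler_norm _) (Cauchy_Schwarz_dot u v).
rewrite -mulr_natl; lra.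
Qed.

Lemma ler_enorm_dist (R : realType) n (u v w : 'cV[R]_n) :
  enorm (u - w) <= enorm (u - v) + enorm (v - w).
Proof. by apply: le_trans (ler_enormD _ _); rewrite addrA subrK. Qed.

Lemma ler_enorm_sub (R : realType) n (u v : 'cV[R]_n) : enorm u <= enorm (u - v) + enorm v.
Proof. by rewrite -{1}[u](subrK v) ler_enormD. Qed.

Lemma ler_norm_coord (R : realType) n (u : 'cV[R]_n) i : `|u i 0| <= enorm u.
Proof.
rewrite -(ler_pXn2r (_ : 0 < 2)%N) ?nnegrE ?enorm_ge0//.
rewrite sqr_enorm real_normK ?num_real// /dot (bigD1 i)//= -expr2 lerDl.
by apply: sumr_ge0 => j _; rewrite -expr2 sqr_ge0.
Qed.

Lemma enorm_ebasis (R : realType) n (i : 'I_n) : enorm (ebasis R i) = 1.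
Proof.
rewrite /enorm /dot (bigD1 i)//= !mxE !eqxx mulr1 big1 ?addr0 ?sqrtr1//.
by move=> j ji; rewrite !mxE (negbTE ji) mul0r.
Qed.

Lemma ler_enorm_sum (R : realType) n (u : 'cV[R]_n) : enorm u <= \sum_i `|u i 0|.
Proof.
have -> : u = \sum_i u i 0 *: ebasis R i.
  apply/colP => k; rewrite summxE (bigD1 k)//= !mxE !eqxx mulr1 big1 ?addr0//.
  by move=> j jk; rewrite !mxE [k == j]eq_sym (negbTE jk) mulr0.
under [leRHS]eq_bigr => k _.
  rewrite summxE (bigD1 k)//= !mxE !eqxx mulr1 big1 ?addr0.
  over.
  by move=> j jk; rewrite !mxE [k == j]eq_sym (negbTE jk) mulr0.
elim/big_ind2 : _ => [|x1 x2 y1 y2 h1 h2|i _].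
- by rewrite enorm0.
- exact: le_trans (ler_enormD _ _) (lerD h1 h2).
by rewrite enormZ enorm_ebasis mulr1.
Qed.

Lemma ler_enorm_mulmx (R : realType) n (A : 'M[R]_n) (u : 'cV[R]_n) :
  enorm (A *m u) <= (\sum_i \sum_j `|A i j|) * enorm u.
Proof.
apply: le_trans (ler_enorm_sum _) _; rewrite mulr_suml; apply: ler_sum => i _.
rewrite mxE; apply: le_trans (ler_norm_sum _ _ _) _; rewrite mulr_suml.
by apply: ler_sum => j _; rewrite normrM ler_wpM2l// ler_norm_coord.
Qed.

(* The eigenvectors of the complexification have real eigenvalues, so their
   real and imaginary parts are real eigenvectors. *)
Lemma symmetric_eigenvectors_span (R : realType) n k (A : 'M[R]_n)
    (Q : 'M[R]_(n, k)) : A^T = A -> Q != 0 ->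
  exists (u : 'rV[R]_n) a, u *m A = a *: u /\ u *m Q != 0.
Proof.
move=> sA Q0; pose toC := real_complex R.
pose AC : 'M[R[i]]_n := map_mx toC A.
have ACh : AC \is hermsymmx.
  apply: realsym_hermsym; last first.
    by apply/mxOverP => i j; rewrite mxE; apply/complex_realP; exists (A i j).
  by apply/is_hermitianmxP; rewrite expr0 scale1r map_mx_id//; apply/matrixP => i j; rewrite !mxE -{1}sA mxE.
have dreal := hermitian_spectral_diag_real ACh.
have /hermitian_normalmx/orthomx_spectralP eA := ACh.
set P := spectralmx AC in eA; set d := spectral_diag AC in eA dreal.
have Pu : P \in unitmx by exact: spectral_unit.
have PA : P *m AC = diag_mx d *m P by rewrite eA !mulmxA mulmxV// mul1mx.
(* [P] is invertible, so [Q] does not kill every row of [P]; for a surviving row, [Q] cannot kill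
   both the real and the imaginary part. *)
have PQ0 : P *m map_mx toC Q != 0.
  apply: contra_neq Q0 => /(congr1 (mulmx (invmx P))).
  rewrite mulKmx// mulmx0 => /matrixP h; apply/matrixP => i j.
  by have := h i j; rewrite !mxE => /complexI.
have [i [j PQij]] : exists i j, (P *m map_mx toC Q) i j != 0.
  apply/not_existsP => h; move/negP: PQ0; apply; apply/eqP/matrixP => i j.
  rewrite [RHS]mxE; apply/eqP; apply: contra_notT (h i) => ?; by exists j.
have /mxOverP/(_ 0 i)/complex_realP[a da] := dreal.
pose u1 : 'rV[R]_n := \row_l complex.Re (P i l).
pose u2 : 'rV[R]_n := \row_l complex.Im (P i l).
have sumC (F : 'I_n -> R[i]) : 
      \sum_l F l = ((\sum_l complex.Re (F l)) +i* (\sum_l complex.Im (F l)))%C.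
  have <- : complex.Re (\sum_l F l) = \sum_l complex.Re (F l).
    by apply: (big_morph (@complex.Re R)) => // -[? ?] [? ?].
  have <- : complex.Im (\sum_l F l) = \sum_l complex.Im (F l).
    by apply: (big_morph (@complex.Im R)) => // -[? ?] [? ?].
  by case: (\sum_l F l).
have e1 : u1 *m A = a *: u1 /\ u2 *m A = a *: u2.
  have h l : \sum_t P i t * (A t l)%:C%C = a%:C%C * P i l.
    have /matrixP/(_ i l) := PA; rewrite mul_diag_mx !mxE da => <-.
    by apply: eq_bigr => t _; rewrite !mxE.
  split; apply/rowP => l; have := h l; rewrite sumC !mxE;
    case: (P i l) => x y /= [] h1 h2.
    transitivity (a * x - 0 * y); last by rewrite mul0r subr0.
    rewrite -h1; apply: eq_bigr => t _; rewrite !mxE; case: (P i t) => ? ? /=.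
    by rewrite mulr0 subr0.
  transitivity (a * y + 0 * x); last by rewrite mul0r addr0.
  rewrite -h2; apply: eq_bigr => t _; rewrite !mxE; case: (P i t) => ? ? /=.
  by rewrite mulr0 add0r.
have [h1|h1] := eqVneq (u1 *m Q) 0; last by exists u1, a; case: e1.
have [h2|h2] := eqVneq (u2 *m Q) 0; last by exists u2, a; case: e1.
case/negP : PQij; rewrite mxE sumC.
have -> : \sum_l complex.Re (P i l * map_mx toC Q l j) = (u1 *m Q) 0 j.
  rewrite mxE; apply: eq_bigr => l _; rewrite !mxE; case: (P i l) => ? ? /=.
  by rewrite mulr0 subr0.
have -> : \sum_l complex.Im (P i l * map_mx toC Q l j) = (u2 *m Q) 0 j.
  rewrite mxE; apply: eq_bigr => l _; rewrite !mxE; case: (P i l) => ? ? /=.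
  by rewrite mulr0 add0r.
by rewrite h1 h2 !mxE.
Qed.

(** Induction on [k], the family being the rows of [P]. The matrix [Q = 1 - P^T P] projects onto
    their orthogonal complement and commutes with [A], so an eigenvector [u] with [u Q != 0] yields
    the new eigenvector [u Q], orthogonal to the previous ones. *)
Lemma orthonormal_eigenfamily (R : realType) n k (A : 'M[R]_n) :
  A^T = A -> (k <= n)%N ->
  exists (P : 'M[R]_(k, n)) (d : 'rV[R]_k), P *m P^T = 1%:M /\ P *m A = diag_mx d *m P.
Proof.
move=> sA; elim: k => [_|k IH kn].
  by exists 0, 0; split; apply/matrixP => -[].
have [P [d [PP PA]]] := IH (ltnW kn).
pose Q : 'M[R]_n := 1%:M - P^T *m P.
have Q0 : Q != 0.
  apply/eqP => /eqP; rewrite subr_eq0 => /eqP h.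
  (* Otherwise the identity of rank [n] would be [P^T P], whose rank is at most [k]. *)
  have := mxrankM_maxr P^T P; rewrite -h mxrank1 => /leq_trans /(_ (rank_leq_row P)).
  by rewrite leqNgt kn.
have AP : A *m P^T = P^T *m diag_mx d.
  by rewrite -{1}sA -trmx_mul PA trmx_mul tr_diag_mx.
have QA : Q *m A = A *m Q.
  by rewrite mulmxBl mulmxBr mul1mx mulmx1 -mulmxA PA !mulmxA AP.
have QP : Q *m P^T = 0 by rewrite mulmxBl mul1mx -mulmxA PP mulmx1 subrr.
have [u [a [ua uQ]]] := symmetric_eigenvectors_span sA Q0.
pose v := u *m Q; pose s := enorm v^T.
have s0 : 0 < s.
  by rewrite enorm_gt0; apply: contra_neq uQ => /(congr1 trmx); rewrite trmxK trmx0.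
have vv : (s^-1 *: v) *m (s^-1 *: v)^T = 1%:M.
  apply/matrixP => i j; rewrite !ord1 [RHS]mxE eqxx linearZ/= -scalemxAl -scalemxAr !mxE.
  have -> : \sum_j v 0 j * v^T j 0 = s ^+ 2.
    by rewrite sqr_enorm dotE trmxK mxE.
  by field; rewrite gt_eqF.
have vP : (s^-1 *: v) *m P^T = 0 by rewrite -scalemxAl -mulmxA QP mulmx0 scaler0.
rewrite -addn1; exists (col_mx P (s^-1 *: v)), (row_mx d (const_mx a)); split.
  rewrite tr_col_mx mul_col_row PP vP vv.
  have -> : P *m (s^-1 *: v)^T = 0 by rewrite -[P]trmxK -trmx_mul vP trmx0.
  by rewrite -scalar_mx_block.
rewrite mul_col_mx PA diag_mx_row mul_block_col !mul0mx addr0 add0r; congr col_mx.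
rewrite -scalemxAl -mulmxA QA mulmxA ua diag_const_mx mul_scalar_mx.
by rewrite -scalemxAl !scalerA mulrC.
Qed.

Lemma spectral_theorem_symmetric (R : realType) n (A : 'M[R]_n) : A^T = A ->
  exists (e : 'I_n -> 'cV[R]_n) (a : 'I_n -> R),
    [/\ forall i j, dot (e i) (e j) = (i == j)%:R,
        forall i, A *m e i = a i *: e i &
        forall u v, dot u v = \sum_i dot u (e i) * dot v (e i)].
Proof.
move=> sA; have [P [d [PP PA]]] := orthonormal_eigenfamily sA (leqnn _).
exists (fun i => (row i P)^T), (fun i => d 0 i); split=> [i j|i|u v].
- have /matrixP/(_ i j) := PP; rewrite !mxE => <-.
  by apply: eq_bigr => l _; rewrite !mxE.
- rewrite -{1}sA -trmx_mul -row_mul PA row_mul row_diag_mx -scalemxAl -rowE.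
  by rewrite linearZ.
have PP' : P^T *m P = 1%:M by exact: mulmx1C.
have e (w : 'cV[R]_n) i : dot w (row i P)^T = (P *m w) i 0.
  by rewrite dotC dotE trmxK -row_mul mxE.
rewrite dotE -[u^T]mulmx1 -PP' -!mulmxA mulmxA -trmx_mul mxE.
by apply: eq_bigr => i _; rewrite !e mxE.
Qed.

(** * Calculus with partial derivatives *)

Lemma is_derive_translate (R : realType) (f : R -> R) (s d : R) :
  is_derive (0 : R) 1 (fun t => f (s + t)) d -> is_derive (s : R) 1 f d.
Proof.
move=> [drv val].
have E : (fun h => h^-1 *: (((fun t => f (s + t)) \o shift 0) (h *: (1 : R)) - f (s + 0)))
  = (fun h => h^-1 *: ((f \o shift s) (h *: (1 : R)) - f s)).
  by apply/funext => h /=; rewrite !addr0 (addrC s).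
by split; [move: drv|move: val]; rewrite /derivable /derive E.
Qed.

Definition partially_derivable (R : realType) n (g : 'cV[R]_n -> R) (i : 'I_n) :=
  forall x, derivable (fun t : R => g (x + t *: ebasis R i)) 0 1.

Lemma is_derive_line (R : realType) n (g : 'cV[R]_n -> R) (i : 'I_n) (x : 'cV[R]_n) (s : R) :
  partially_derivable g i ->
  is_derive (s : R) 1 (fun t : R => g (x + t *: ebasis R i))
    (partial i g (x + s *: ebasis R i)).
Proof.
move=> dg; apply: is_derive_translate; rewrite /partial derive1E.
under eq_fun do rewrite scalerDl addrA.
exact/derivableP/dg.
Qed.

Lemma partial_MVT (R : realType) n (g : 'cV[R]_n -> R) (i : 'I_n) (x : 'cV[R]_n) (h : R) :
  partially_derivable g i ->
  exists2 c, `|c| <= `|h| &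
    g (x + h *: ebasis R i) - g x = partial i g (x + c *: ebasis R i) * h.
Proof.
move=> dg; pose G t := g (x + t *: ebasis R i).
pose dG t := partial i g (x + t *: ebasis R i).
have GdG (t : R) : is_derive t 1 G (dG t) by exact: is_derive_line.
have Gc a b : {within `[a, b], continuous G}%classic.
  by apply: derivable_within_continuous => t _; case: (GdG t).
have G0 : G 0 = g x by rewrite /G scale0r addr0.
have [h0|h0] := leP 0 h.
  have [c] := MVT_segment h0 (fun t _ => GdG t) (Gc _ _).
  rewrite in_itv/= => /andP[c0 ch]; rewrite subr0 G0 => e.
  by exists c; rewrite ?ger0_norm.
have [c] := MVT_segment (ltW h0) (fun t _ => GdG t) (Gc _ _).
rewrite in_itv/= => /andP[ch c0]; rewrite sub0r G0 mulrN => e.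
exists c; first by rewrite !ler0_norm ?lerN2// ltW.
by rewrite -[RHS]opprK -e opprB.
Qed.

(** The mean value theorem is applied twice: to the increment [k y = g (y + h e_j) - g y] along
    [e_i], then to [partial i g] along [e_j]. *)
Lemma second_difference (R : realType) n (g : 'cV[R]_n -> R) (i j : 'I_n) (x : 'cV[R]_n) (h : R) :
  partially_derivable g i -> partially_derivable (partial i g) j ->
  exists2 y, enorm (y - x) <= 2 * `|h| &
    g (x + h *: ebasis R i + h *: ebasis R j) - g (x + h *: ebasis R i)
    - g (x + h *: ebasis R j) + g x = partial j (partial i g) y * h * h.
Proof.
move=> di dij; pose k y := g (y + h *: ebasis R j) - g y.
have kE y : is_derive (0 : R) 1 (fun t : R => k (y + t *: ebasis R i))
    (partial i g (y + h *: ebasis R j) - partial i g y).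
  rewrite /k; under eq_fun do rewrite addrAC.
  apply: is_deriveB.
    by have := is_derive_line (y + h *: ebasis R j) 0 di; rewrite scale0r addr0.
  by have := is_derive_line y 0 di; rewrite scale0r addr0.
have dk : partially_derivable k i by move=> y; case: (kE y).
have pk y : partial i k y = partial i g (y + h *: ebasis R j) - partial i g y.
  by rewrite /partial derive1E; have [_ ->] := kE y.
have [c ch kc] := partial_MVT x h dk.
have [c' ch' kc'] := partial_MVT (x + c *: ebasis R i) h dij.
exists (x + c *: ebasis R i + c' *: ebasis R j).
  rewrite addrAC (addrAC x) subrr add0r.
  apply: le_trans (ler_enormD _ _) _; rewrite !enormZ !enorm_ebasis !mulr1.
  by rewrite mulr_natl mulr2n lerD.
rewrite -kc' -pk -kc /k; ring.
Qed.

Lemma econt_eq_nearby (R : realType) n (F G : 'cV[R]_n -> R) (x : 'cV[R]_n) :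
  econt F -> econt G ->
  (forall d, 0 < d -> exists y z, [/\ enorm (y - x) < d, enorm (z - x) < d & F y = G z]) ->
  F x = G x.
Proof.
move=> cF cG near; apply/eqP/negPn/negP => ab.
have e0 : 0 < `|F x - G x| / 2 by rewrite divr_gt0 ?normr_gt0 ?subr_eq0.
have [d1 d1_gt0 h1] := cF x _ e0.
have [d2 d2_gt0 h2] := cG x _ e0.
have d_gt0 : 0 < Num.min d1 d2 by rewrite lt_min d1_gt0.
have [y [z [+ + yz]]] := near _ d_gt0.
rewrite !lt_min => /andP[/h1 + _] /andP[_ /h2]; rewrite yz => Fx Gx.
rewrite distrC in Fx; have := le_lt_trans (ler_distD (G z) _ _) (ltrD Fx Gx).
by rewrite -splitr ltxx.
Qed.

(** The second difference is symmetric in [i] and [j], so the two mixed partials agree at two points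
    arbitrarily close to [x]; continuity transfers this to [x]. *)
Lemma partialC (R : realType) n (g : 'cV[R]_n -> R) (i j : 'I_n) x :
  Ck 2 g -> partial j (partial i g) x = partial i (partial j g) x.
Proof.
move=> [_ [d1 C1]].
apply: econt_eq_nearby => [||d d0]; [exact: (C1 i).2.2|exact: (C1 j).2.2|].
have h_gt0 : 0 < d / 3 by rewrite divr_gt0.
have [y1 y1x e1] := second_difference x (d / 3) (d1 i) ((C1 i).2.1 j).
have [y2 y2x e2] := second_difference x (d / 3) (d1 j) ((C1 j).2.1 i).
have hh : 2 * `|d / 3| < d.
  rewrite gtr0_norm// mulrCA gtr_pMr//.
  by rewrite ltr_pdivrMr// mul1r ltr_nat.
exists y1, y2; split; [exact: le_lt_trans hh|exact: le_lt_trans hh|].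
apply: (mulIf (lt0r_neq0 h_gt0)); apply: (mulIf (lt0r_neq0 h_gt0)).
apply: etrans (esym e1) (etrans _ e2).
by rewrite [x + _ + _ *: ebasis R i]addrAC; congr (_ + _); exact: addrAC.
Qed.

Lemma hessian_sym (R : realType) n (g : 'cV[R]_n -> R) x : Ck 2 g -> (hessian g x)^T = hessian g x.
Proof. by move=> C2; apply/matrixP => i j; rewrite !mxE partialC. Qed.

(** The inverse of [1 + \sum_i (d_ i)^-1] is below every [d_ i], and it stays positive when [I] is
    empty. *)
Lemma uniform_radius (R : realType) (I : finType) (P : I -> R -> Prop) :
  (forall i d d', 0 < d' <= d -> P i d -> P i d') ->
  (forall i, exists2 d, 0 < d & P i d) -> exists2 d, 0 < d & forall i, P i d.
Proof.
move=> Pmono PP.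
have [d_ dP] : {d_ : I -> R & forall i, 0 < d_ i /\ P i (d_ i)}.
  by apply: (@boolp.choice _ _ (fun i d => 0 < d /\ P i d)) => i; have [d d0 Pd] := PP i; exists d.
have S0 : 0 < 1 + \sum_i (d_ i)^-1.
  by rewrite ltr_pwDl// sumr_ge0// => i _; rewrite invr_ge0 ltW//; case: (dP i).
exists (1 + \sum_i (d_ i)^-1)^-1; first by rewrite invr_gt0.
move=> i; have [di0 Pi] := dP i; apply: Pmono Pi; rewrite invr_gt0 S0/=.
rewrite invf_ple ?posrE// (bigD1 i)//= addrCA lerDl addr_ge0// sumr_ge0// => j _.
by rewrite invr_ge0 ltW//; case: (dP j).
Qed.

Definition C1 (R : realType) n (g : 'cV[R]_n -> R) :=
  forall i, partially_derivable g i /\ econt (partial i g).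

Lemma Ck_econt (R : realType) n k (g : 'cV[R]_n -> R) : Ck k g -> econt g.
Proof. by case: k => [|k] // []. Qed.

Lemma Ck_C1 (R : realType) n k (g : 'cV[R]_n -> R) : Ck k.+1 g -> C1 g.
Proof. by move=> [_ [d c]] i; split; [exact: d|exact: Ck_econt (c i)]. Qed.

Lemma Ck_leq (R : realType) n k (g : 'cV[R]_n -> R) : Ck k.+1 g -> Ck k g.
Proof.
elim: k g => [|k IH] g; first by case.
by move=> [c [d h]]; split=> //; split=> // i; apply: IH.
Qed.

Lemma partials_uniform_continuous (R : realType) n (g : 'cV[R]_n -> R) (x : 'cV[R]_n) (e : R) :
  C1 g -> 0 < e -> exists2 d, 0 < d & forall y i, enorm (y - x) < d ->
    `|partial i g y - partial i g x| < e.
Proof.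
move=> g1 e0; have [d d0 h] : exists2 d, 0 < d & forall i, forall y, enorm (y - x) < d ->
    `|partial i g y - partial i g x| < e.
  apply: uniform_radius => [i d d' /andP[_ dd] h y yx|i].
    by apply: h; exact: lt_le_trans dd.
  exact: (g1 i).2.
by exists d => // y i; exact: h.
Qed.

Lemma sum_const_fraction_lt (R : realType) n (e : R) : 0 < e ->
  \sum_(i < n) (e / n.+1%:R) < e.
Proof.
move=> e0; rewrite sumr_const card_ord -[X in X < _]mulr_natr -mulrA gtr_pMr//.
by rewrite mulrC ltr_pdivrMr// mul1r ltr_nat.
Qed.

Lemma grad_continuous (R : realType) n (g : 'cV[R]_n -> R) (x : 'cV[R]_n) (e : R) :
  C1 g -> 0 < e -> exists2 d, 0 < d & forall y, enorm (y - x) < d ->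
    enorm (grad g y - grad g x) < e.
Proof.
move=> g1 e0; have e1 : 0 < e / n.+1%:R by rewrite divr_gt0.
have [d d0 h] := partials_uniform_continuous x g1 e1; exists d => // y yx.
apply: le_lt_trans (ler_enorm_sum _) _.
apply: le_lt_trans (sum_const_fraction_lt n e0).
by apply: ler_sum => i _; rewrite !mxE ltW// h.
Qed.

(** Going from [x] to [y] one coordinate at a time, each increment is a partial derivative at a
    point near [xs] times the change of that coordinate. Both endpoints vary, as a single radius has
    to serve all base points near [xs]. *)
Lemma strictly_differentiable (R : realType) n (g : 'cV[R]_n -> R) (xs : 'cV[R]_n) (e : R) :
  C1 g -> 0 < e -> exists2 d, 0 < d & forall x y,
    enorm (x - xs) < d -> enorm (y - xs) < d ->
    `|g y - g x - dot (grad g xs) (y - x)| <= e * enorm (y - x).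
Proof.
move=> g1 e0; have e1 : 0 < e / n.+1%:R by rewrite divr_gt0.
have [d0 d0_gt0 h] := partials_uniform_continuous xs g1 e1.
(* Each coordinate of an intermediate point is within [d + 2 d = d0 / (n + 1)] of that of [xs], and
   [n] such bounds add up to less than [d0]. *)
exists (d0 / (3 * n.+1%:R)); first by rewrite divr_gt0 ?mulr_gt0.
set d := d0 / _ => x y xd yd.
(* The corners of the path: the first [k] coordinates come from [y], the others from [x]. *)
pose z k : 'cV[R]_n := \col_i (if (i < k)%N then y i 0 else x i 0).
have z0 : z 0%N = x by apply/colP => i; rewrite mxE.
have zn : z n = y by apply/colP => i; rewrite mxE ltn_ord.
have zS (k : 'I_n) : z k.+1 = z k + (y k 0 - x k 0) *: ebasis R k.
  apply/colP => i; rewrite !mxE ltnS leq_eqVlt [i == k]/eq_op/= eqxx andbT.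
  have [ik|ik] /= := eqVneq (i : nat) k.
    by rewrite ik ltnn (val_inj ik) mulr1 addrC subrK.
  by rewrite mulr0 addr0.
have gE : g y - g x = \sum_(k < n) (g (z k.+1) - g (z k)).
  by rewrite -(big_mkord xpredT (fun k => g (z k.+1) - g (z k))) telescope_sumr// z0 zn.
have yx i : `|y i 0 - x i 0| <= enorm (y - x).
  by have := ler_norm_coord (y - x) i; rewrite !mxE.
have yxd : enorm (y - x) < 2 * d.
  apply: le_lt_trans (ler_enorm_dist y xs x) _; rewrite (enorm_distC xs x); lra.
rewrite gE /dot -sumrB; apply: le_trans (ler_norm_sum _ _ _) _.
apply: le_trans (_ : \sum_(k < n) (e / n.+1%:R) * enorm (y - x) <= _); last first.
  by rewrite -mulr_suml ler_wpM2r ?enorm_ge0// ltW// sum_const_fraction_lt.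
apply: ler_sum => k _; rewrite !mxE zS.
have [c cyx ->] := partial_MVT (z k) (y k 0 - x k 0) (g1 k).1.
rewrite -mulrBl normrM ler_pM// ltW// h//.
apply: le_lt_trans (ler_enorm_sum _) _.
apply: le_lt_trans (sum_const_fraction_lt n d0_gt0).
apply: ler_sum => i _; rewrite !mxE.
have -> : d0 / n.+1%:R = 3 * d.
  by rewrite /d invfM mulrCA mulVKf// pnatr_eq0.
have cd : `|c| <= 2 * d by rewrite (le_trans cyx)// (le_trans (yx k))// ltW.
have cb : `|c * ((i == k) && (0 == 0 :> 'I_1))%:R| <= 2 * d.
  apply: le_trans cd; rewrite normrM ler_piMr//.
  by case: (_ && _); rewrite ?normr1 ?normr0.
have xi := le_lt_trans (ler_norm_coord _ i) xd.
have yi := le_lt_trans (ler_norm_coord _ i) yd.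
rewrite !mxE in xi yi.
rewrite addrAC; apply: le_trans (ler_normD _ _) _.
case: ifP => _; lra.
Qed.

Lemma hessian_locally_bounded (R : realType) n (g : 'cV[R]_n -> R) (x : 'cV[R]_n) :
  Ck 2 g -> exists2 d, 0 < d & exists2 B, 0 < B & forall y, enorm (y - x) < d ->
    \sum_i \sum_j `|hessian g y i j| <= B.
Proof.
move=> [_ [_ g2]].
have [d d0 h] : exists2 d, 0 < d & forall i : 'I_n * 'I_n,
   forall y, enorm (y - x) < d ->
    `|partial i.2 (partial i.1 g) y - partial i.2 (partial i.1 g) x| < 1.
  apply: uniform_radius => [i d d' /andP[_ dd] h y yx|[i j]].
    by apply: h; exact: lt_le_trans dd.
  exact: (g2 i).2.2 j x 1 ltr01.
exists d => //; exists (1 + \sum_(i < n) \sum_(j < n) (1 + `|hessian g x i j|)).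
  apply: ltr_pwDl => //; apply: sumr_ge0 => i _; apply: sumr_ge0 => j _.
  exact: addr_ge0.
move=> y yx; rewrite ler_wpDl//; apply: ler_sum => i _; apply: ler_sum => j _.
rewrite -lerBlDr; apply: le_trans (lerB_dist _ _) _.
have hE z : hessian g z i j = partial j (partial i g) z by rewrite mxE.
have e := f_equal2 (fun a b => `|a - b|) (hE y) (hE x).
by apply: ltW; exact: (eq_ind_r (fun z => z < 1) (h (i, j) y yx) e).
Qed.

Lemma ebasis_lshift (R : realType) m n (i : 'I_m) :
  ebasis R (lshift n i) = col_mx (ebasis R i) 0.
Proof.
apply/colP => k; rewrite -[k]splitK; case: (fintype.split k) => l /=; rewrite ?col_mxEu ?col_mxEd !mxE.
  by rewrite (inj_eq (@lshift_inj _ _)).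
by rewrite eq_rlshift.
Qed.

Lemma ebasis_rshift (R : realType) m n (i : 'I_n) :
  ebasis R (rshift m i) = col_mx 0 (ebasis R i).
Proof.
apply/colP => k; rewrite -[k]splitK; case: (fintype.split k) => l /=; rewrite ?col_mxEu ?col_mxEd !mxE.
  by rewrite eq_lrshift.
by rewrite (inj_eq (@rshift_inj _ _)).
Qed.

(** [gradF f] is linear in its second block, and symmetry of the Hessian identifies the derivative
    in the first. This turns [grad_loj] into an inequality between the Hessian and the gradient of
    [f]. *)
Lemma grad_gradF (R : realType) m (f : 'cV[R]_m -> R) (x y : 'cV[R]_m) : Ck 2 f ->
  grad (gradF f) (col_mx x y) = col_mx (hessian f x *m y) (grad f x).
Proof.
move=> f2; have d2 i j := (f2.2.2 i).2.1 j.
apply/colP => k; rewrite -[k]splitK; case: (fintype.split k) => i /=; rewrite ?col_mxEu ?col_mxEd mxE.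
  rewrite /partial ebasis_lshift /gradF.
  have -> : (fun t : R => dot (grad f (usubmx (col_mx x y + t *: col_mx (ebasis R i) 0)))
      (dsubmx (col_mx x y + t *: col_mx (ebasis R i) 0))) =
    \sum_(j < m) (y j 0 \*: (fun t : R => partial j f (x + t *: ebasis R i))).
    apply/funext => t; rewrite fct_sumE scale_col_mx add_col_mx col_mxKu col_mxKd.
    by apply: eq_bigr => j _; rewrite scaler0 addr0 mxE [RHS]mulrC.
  rewrite derive1E derive_sum; last first.
    by move=> j; apply: derivableZ; exact: (d2 j i).
  rewrite mxE; apply: eq_bigr => j _; rewrite deriveZ; last exact: (d2 j i).
  by rewrite -derive1E mxE partialC// mulrC.
rewrite /partial ebasis_rshift /gradF.
have -> : (fun t : R => dot (grad f (usubmx (col_mx x y + t *: col_mx 0 (ebasis R i))))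
      (dsubmx (col_mx x y + t *: col_mx 0 (ebasis R i)))) =
    cst (dot (grad f x) y) + (grad f x i 0) \*: id.
  apply/funext => t; rewrite scale_col_mx add_col_mx col_mxKu col_mxKd.
  rewrite scaler0 addr0 dotDr dotZr; congr (_ + _); rewrite mulrC; congr (_ * _).
  rewrite /dot (bigD1 i)//= big1 ?addr0 => [|j ji]; rewrite !mxE ?eqxx ?mulr1//.
  by rewrite (negbTE ji) mulr0.
rewrite derive1E deriveD// deriveZ// derive_cst derive_id add0r.
by rewrite /GRing.scale/= mulr1.
Qed.

Lemma enorm_col_mx (R : realType) m n (x : 'cV[R]_m) (y : 'cV[R]_n) :
  enorm (col_mx x y) <= enorm x + enorm y.
Proof.
rewrite -(ler_pXn2r (_ : 0 < 2)%N) ?nnegrE ?addr_ge0 ?enorm_ge0//.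
rewrite sqrrD !sqr_enorm dotE tr_col_mx mul_row_col mxE -!dotE addrAC lerDl.
by rewrite mulrn_wge0// mulr_ge0// enorm_ge0.
Qed.

(** * The direction of a BNQN step *)

Lemma dot_suml (R : realType) n k (F : 'I_k -> 'cV[R]_n) (v : 'cV[R]_n) :
  dot (\sum_i F i) v = \sum_i dot (F i) v.
Proof.
by apply: (big_morph (fun u => dot u v)) => [? ?|]; rewrite ?dotDl ?dot0l.
Qed.

Lemma symmetric_eigvec_orth (R : realType) n (A : 'M[R]_n) a b (u v : 'cV[R]_n) :
  A^T = A -> A *m u = a *: u -> A *m v = b *: v -> a != b -> dot u v = 0.
Proof.
move=> sA Au Av ab; have : (a - b) * dot u v = 0.
  by rewrite mulrBl -dotZl -Au dot_mulmxl sA Av dotZr subrr.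
by move=> /eqP; rewrite mulf_eq0 subr_eq0 (negbTE ab) => /eqP.
Qed.

Lemma dot_span_eq0 (R : realType) n (S : set 'cV[R]_n) (u v : 'cV[R]_n) :
  Defs.span S u -> (forall s, S s -> dot s v = 0) -> dot u v = 0.
Proof.
move=> [k [c [vs [Svs ->]]]] h; rewrite dot_suml big1// => i _.
by rewrite dotZl h ?mulr0.
Qed.

Lemma sub_span (R : realType) n (S : set 'cV[R]_n) (u : 'cV[R]_n) : S u -> Defs.span S u.
Proof.
move=> Su; exists 1%N, (fun=> 1), (fun=> u); split=> //.
by rewrite big_ord1 scale1r.
Qed.

(* [dot w (e i) * `|a i| = dot g (e i)] says that [w] is |A|^-1 g. *)
Lemma modified_newton_direction (R : realType) n (A : 'M[R]_n) (s : R) (g p q : 'cV[R]_n) :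
  A^T = A -> 0 < s -> s <= minsp A ->
  orth_proj (pos_space A) (invmx A *m g) p -> orth_proj (neg_space A) (invmx A *m g) q ->
  exists (e : 'I_n -> 'cV[R]_n) (a : 'I_n -> R),
    [/\ forall u v, dot u v = \sum_i dot u (e i) * dot v (e i),
        forall i, enorm (e i) = 1, forall i, A *m e i = a i *: e i,
        forall i, s <= `|a i| & forall i, dot (p - q) (e i) * `|a i| = dot g (e i)].
Proof.
move=> sA s0 sA' [Pp vp] [Nq vq].
have [e [a [ee Ae Parseval]]] := spectral_theorem_symmetric sA.
have e1 i : e i != 0 by rewrite -dotvv_eq0 ee eqxx oner_eq0.
have sa i : s <= `|a i|.
  apply: le_trans sA' _; apply: ge_inf; first by exists 0 => _ [b _ <-].
  by exists (a i) => //; exists (e i).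
have a0 i : a i != 0 by rewrite -normr_gt0 (lt_le_trans s0).
have Au : A \in unitmx.
  rewrite -row_free_unit; apply: inj_row_free => r rA0.
  have Ar0 : A *m r^T = 0 by rewrite -{1}sA -trmx_mul rA0 trmx0.
  suff : r^T = 0 by move=> /(congr1 trmx); rewrite trmxK trmx0.
  apply/eqP; rewrite -dotvv_eq0 Parseval big1// => i _.
  suff -> : dot r^T (e i) = 0 by rewrite mul0r.
  apply: (mulfI (a0 i)); rewrite mulr0 -dotZr -Ae dotC dot_mulmxl sA Ar0.
  by rewrite dotC dot0l.
set v := invmx A *m g in vp vq.
have vg i : dot v (e i) * a i = dot g (e i).
  by rewrite mulrC -dotZr -Ae dotC dot_mulmxl sA mulKVmx// dotC.
exists e, a; split=> // [i|i]; first by rewrite /enorm ee eqxx sqrtr1.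
(* Eigenvectors for eigenvalues of opposite signs are orthogonal, so only one of [p], [q] has a
   component along [e i], namely that of [v]. The sign of [q] in [p - q] replaces [a i] by its
   absolute value. *)
rewrite dotBl; have [ai|ai|ai] := ltgtP (a i) 0; last by have := a0 i; rewrite ai eqxx.
- rewrite ler0_norm ?ltW// mulrN -mulNr -vg; congr (_ * _).
  have -> : dot p (e i) = 0.
    apply: dot_span_eq0 Pp _ => t [b [b0 [_ Atb]]].
    by apply: symmetric_eigvec_orth Atb (Ae i) _ => //; rewrite gt_eqF// (lt_trans ai).
  have /vq : neg_space A (e i) by apply: sub_span; exists (a i); split.
  by rewrite dotBl => /eqP; rewrite subr_eq0 => /eqP ->; rewrite sub0r opprK.
- rewrite ger0_norm ?ltW// -vg; congr (_ * _).
  have -> : dot q (e i) = 0.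
    apply: dot_span_eq0 Nq _ => t [b [b0 [_ Atb]]].
    by apply: symmetric_eigvec_orth Atb (Ae i) _ => //; rewrite lt_eqF// (lt_trans b0).
  have /vp : pos_space A (e i) by apply: sub_span; exists (a i); split.
  by rewrite dotBl => /eqP; rewrite subr_eq0 => /eqP ->; rewrite subr0.
Qed.

(** In coordinates, [dot w g] is the sum of the [w_i^2 |a_i|], while [w_i^2] and [w_i^2 |a_i|^2] sum
    to the squared norms of [w] and [g]. This lemma and the next compare these sums term by term. *)
Lemma direction_curvature (R : realType) n (e : 'I_n -> 'cV[R]_n) (a : 'I_n -> R)
    (w g : 'cV[R]_n) (s : R) :
  (forall u v, dot u v = \sum_i dot u (e i) * dot v (e i)) ->
  (forall i, s <= `|a i|) -> (forall i, dot w (e i) * `|a i| = dot g (e i)) ->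
  s * enorm w ^+ 2 <= dot w g.
Proof.
move=> Parseval sa wg; rewrite sqr_enorm !Parseval mulr_sumr; apply: ler_sum => i _.
by rewrite -wg [leRHS]mulrA [leRHS]mulrC -expr2 ler_wpM2r// sqr_ge0.
Qed.

Lemma direction_gradient (R : realType) n (e : 'I_n -> 'cV[R]_n) (a : 'I_n -> R)
    (w g : 'cV[R]_n) (B : R) :
  (forall u v, dot u v = \sum_i dot u (e i) * dot v (e i)) ->
  (forall i, `|a i| <= B) -> (forall i, dot w (e i) * `|a i| = dot g (e i)) ->
  enorm g ^+ 2 <= B * dot w g.
Proof.
move=> Parseval aB wg; rewrite sqr_enorm !Parseval mulr_sumr; apply: ler_sum => i _.
rewrite -wg mulrACA -!expr2 [leRHS](_ : _ = dot w (e i) ^+ 2 * (B * `|a i|)); last by ring.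
by rewrite ler_wpM2l ?sqr_ge0// expr2 ler_wpM2r.
Qed.

(** The square root of the product of the two hypotheses. *)
Lemma angle_bound (R : realType) n (w g : 'cV[R]_n) (s B : R) : 0 < s -> 0 < B ->
  s * enorm w ^+ 2 <= dot w g -> enorm g ^+ 2 <= B * dot w g ->
  Num.sqrt (s / B) * (enorm w * enorm g) <= dot w g.
Proof.
move=> s0 B0 h1 h2.
have u0 : 0 <= s * enorm w ^+ 2.
  exact: mulr_ge0 (ltW s0) (exprn_ge0 _ (enorm_ge0 _)).
have wg0 := le_trans u0 h1.
rewrite -(ler_pXn2r (_ : 0 < 2)%N) ?nnegrE ?mulr_ge0 ?enorm_ge0 ?sqrtr_ge0//.
rewrite exprMn sqr_sqrtr; last by rewrite divr_ge0// ltW.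
rewrite exprMn.
have h := ler_pM u0 (exprn_ge0 2 (enorm_ge0 g)) h1 h2.
rewrite mulrAC ler_pdivrMr// mulrA.
by have -> : dot w g ^+ 2 * B = dot w g * (B * dot w g) by ring.
Qed.

(** The default value of the minima, [|delta ord0 - delta ord_max|], is itself one of the distances
    as soon as [0 < m]; for [m = 0] it is 0. *)
Lemma kappa_gt0 (R : realType) m (delta : 'I_m.+1 -> R) :
  (0 < m)%N -> injective delta -> 0 < kappa delta.
Proof.
move=> m0 dinj; have p i j : i != j -> 0 < `|delta i - delta j|.
  by move=> ij; rewrite normr_gt0 subr_eq0 (inj_eq dinj).
have p0 : 0 < `|delta ord0 - delta ord_max|.
  by apply: p; rewrite -val_eqE/= eq_sym -lt0n.
rewrite /kappa divr_gt0//; elim/big_ind: _ => // [x y x0 y0|i _].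
  by rewrite lt_min x0.
elim/big_ind: _ => // [x y x0 y0|j ji]; first by rewrite lt_min x0.
by apply: p; rewrite eq_sym.
Qed.

Lemma shiftA_sym (R : realType) m (f : 'cV[R]_m -> R) delta tau x j :
  Ck 2 f -> (shiftA f delta tau x j)^T = shiftA f delta tau x j.
Proof. by move=> f2; rewrite linearD/= hessian_sym// tr_scalar_mx. Qed.

Lemma bnqn_step_critical (R : realType) m (f : 'cV[R]_m -> R) delta tau gamma0 x y :
  grad f x = 0 -> bnqn_step f delta tau gamma0 x y -> y = x.
Proof. by move=> g0; rewrite /bnqn_step g0 eqxx. Qed.

Definition normalized (R : realType) m (w : 'cV[R]_m) := (Num.max 1 (enorm w))^-1 *: w.

(** The spectral form of a step, from which all later estimates start. Positivity of [kappa delta]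
    is part of the conclusion: a nonzero gradient excludes dimension 0. *)
Lemma bnqn_stepP (R : realType) m (f : 'cV[R]_m -> R) delta tau gamma0 x y :
  Ck 2 f -> injective delta -> grad f x <> 0 -> bnqn_step f delta tau gamma0 x y ->
  exists j w nn (e : 'I_m -> 'cV[R]_m) (a : 'I_m -> R),
    [/\ 0 < kappa delta, y = x - (gamma0 / 3 ^+ nn) *: normalized w,
        armijo f x (normalized w) (gamma0 / 3 ^+ nn) &
        forall k, (k < nn)%N -> ~ armijo f x (normalized w) (gamma0 / 3 ^+ k)] /\
    [/\ forall u v, dot u v = \sum_i dot u (e i) * dot v (e i),
        forall i, enorm (e i) = 1, forall i, shiftA f delta tau x j *m e i = a i *: e i,
        forall i, kappa delta * enorm (grad f x) `^ tau <= `|a i| &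
        forall i, dot w (e i) * `|a i| = dot (grad f x) (e i)].
Proof.
move=> f2 dinj g0; rewrite /bnqn_step; case: eqP => // _.
move=> [j [p [q [nn [[sA _] [pp qq] arm mini ->]]]]].
have k0 : 0 < kappa delta.
  apply: kappa_gt0 => //; rewrite lt0n; apply/eqP => m0; subst m.
  by apply: g0; apply/colP => -[].
have s0 : 0 < kappa delta * enorm (grad f x) `^ tau.
  by rewrite mulr_gt0// powR_gt0// enorm_gt0; apply/eqP.
have [e [a h]] := modified_newton_direction (shiftA_sym _ _ _ _ f2) s0 sA pp qq.
by exists j, (p - q), nn, e, a; split.
Qed.

Lemma enorm_normalized_le1 (R : realType) m (w : 'cV[R]_m) : enorm (normalized w) <= 1.
Proof.
have M0 : 0 < Num.max 1 (enorm w) by rewrite lt_max ltr01.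
by rewrite enormZ gtr0_norm ?invr_gt0// mulrC ler_pdivrMr// mul1r le_max lexx orbT.
Qed.

Lemma enorm_normalized_le (R : realType) m (w : 'cV[R]_m) : enorm (normalized w) <= enorm w.
Proof.
have M0 : 0 < Num.max 1 (enorm w) by rewrite lt_max ltr01.
rewrite enormZ gtr0_norm ?invr_gt0// ler_piMl ?enorm_ge0// invf_le1//.
by rewrite le_max lexx.
Qed.

Lemma normalized_dot_bound (R : realType) m (w g : 'cV[R]_m) c :
  c * enorm w <= dot w g -> c * enorm (normalized w) <= dot (normalized w) g.
Proof.
have M0 : 0 < Num.max 1 (enorm w) by rewrite lt_max ltr01.
move=> h; rewrite enormZ dotZl gtr0_norm ?invr_gt0// mulrCA.
by rewrite ler_pM2l ?invr_gt0.
Qed.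

Lemma enorm_normalized_ge (R : realType) m (w : 'cV[R]_m) b : 0 <= b ->
  b <= 1 -> b <= enorm w -> b <= enorm (normalized w).
Proof.
move=> b0 b1 bw; have M0 : 0 < Num.max 1 (enorm w) by rewrite lt_max ltr01.
rewrite enormZ gtr0_norm ?invr_gt0// mulrC ler_pdivlMr//.
have [w1|w1] := leP (enorm w) 1; first by rewrite mulr1.
by rewrite ler_piMl// enorm_ge0.
Qed.

Lemma grad_locally_bounded (R : realType) n (g : 'cV[R]_n -> R) (x : 'cV[R]_n) :
  C1 g -> exists2 d, 0 < d & forall y, enorm (y - x) < d ->
    enorm (grad g y) <= enorm (grad g x) + 1.
Proof.
move=> g1; have [d d0 h] := grad_continuous x g1 ltr01; exists d => // y yx.
apply: le_trans (ler_enorm_sub _ (grad g x)) _; rewrite addrC lerD2l.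
exact: ltW (h y yx).
Qed.

(** The bound is uniform in [j], because the index selected by the method changes from point to
    point. *)
Lemma shiftA_locally_bounded (R : realType) m (f : 'cV[R]_m -> R)
    (delta : 'I_m.+1 -> R) tau (x : 'cV[R]_m) : Ck 2 f -> 0 < tau ->
  exists2 d, 0 < d & exists2 B, 0 < B & forall y j u, enorm (y - x) < d ->
    enorm (shiftA f delta tau y j *m u) <= B * enorm u.
Proof.
move=> f2 t0; have [d1 d10 [B B0 hB]] := hessian_locally_bounded x f2.
have [d2 d20 hG] := grad_locally_bounded x (Ck_C1 f2).
have G0 : 0 < enorm (grad f x) + 1 by rewrite ltr_wpDl// enorm_ge0.
exists (Num.min d1 d2); first by rewrite lt_min d10.
exists (B + (\sum_j `|delta j|) * (enorm (grad f x) + 1) `^ tau).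
  by rewrite ltr_pwDl// mulr_ge0 ?powR_ge0// sumr_ge0.
move=> y j u; rewrite lt_min => /andP[/hB HB /hG HG].
rewrite mulmxDl mulrDl; apply: le_trans (ler_enormD _ _) _; apply: lerD.
  by apply: le_trans (ler_enorm_mulmx _ _) _; rewrite ler_wpM2r ?enorm_ge0.
rewrite mul_scalar_mx enormZ ler_wpM2r ?enorm_ge0// normrM ler_pM//.
  by rewrite (bigD1 j)//= lerDl sumr_ge0.
by rewrite ger0_norm ?powR_ge0// ge0_ler_powR// ?nnegrE ?enorm_ge0 ?ltW.
Qed.

Lemma eigenvalue_bound (R : realType) n (A : 'M[R]_n) (e : 'cV[R]_n) (a B : R) :
  enorm e = 1 -> A *m e = a *: e -> enorm (A *m e) <= B * enorm e -> `|a| <= B.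
Proof. by move=> e1 ->; rewrite enormZ e1 !mulr1. Qed.

(** The angle bound with [s = kappa |g|^tau] gives the factor [|g|^(1 + tau / 2)], and Armijo's
    condition converts it into decrease. The point [xs] is arbitrary: the constant depends on it
    only through the local bound [B] of the shifted Hessians. *)
Lemma bnqn_sufficient_decrease (R : realType) m (f : 'cV[R]_m -> R) delta tau gamma0
    (xs : 'cV[R]_m) :
  Ck 2 f -> injective delta -> 0 < tau -> 0 < gamma0 ->
  exists2 r, 0 < r & exists2 c, 0 < c & forall x y, enorm (x - xs) < r ->
    bnqn_step f delta tau gamma0 x y ->
    c * enorm (grad f x) `^ (1 + tau / 2) * enorm (y - x) <= f x - f y.
Proof.
move=> f2 dinj t0 gam0.
have [r r0 [B B0 hB]] := shiftA_locally_bounded delta xs f2 t0.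
exists r => //.
(* In this case [bnqn_stepP] excludes noncritical points, and at critical ones [y = x]. *)
have [k0|k0] := leP (kappa delta) 0.
  exists 1 => // x y xr xy; have [g0|/eqP g0] := eqVneq (grad f x) 0.
    by rewrite (bnqn_step_critical g0 xy) !subrr enorm0 mulr0.
  have [j [w [nn [e [a [[]]]]]]] := bnqn_stepP f2 dinj g0 xy.
  by rewrite ltNge k0.
exists (Num.sqrt (kappa delta / B) / 3); first by rewrite divr_gt0// sqrtr_gt0 divr_gt0.
move=> x y xr xy; have [g0|/eqP g0] := eqVneq (grad f x) 0.
  by rewrite (bnqn_step_critical g0 xy) !subrr enorm0 mulr0.
have [j [w [nn [e [a [[_ yE arm _] [Pars e1 Ae sa wg]]]]]]] := bnqn_stepP f2 dinj g0 xy.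
have gx0 : 0 < enorm (grad f x) by rewrite enorm_gt0; apply/eqP.
have s0 : 0 < kappa delta * enorm (grad f x) `^ tau by rewrite mulr_gt0// powR_gt0.
have aB i : `|a i| <= B by apply: eigenvalue_bound (e1 i) (Ae i) (hB _ _ _ xr).
have h1 := direction_curvature Pars sa wg.
have h2 := direction_gradient Pars aB wg.
have := angle_bound s0 B0 h1 h2.
have -> : Num.sqrt (kappa delta * enorm (grad f x) `^ tau / B) * (enorm w * enorm (grad f x))
   = Num.sqrt (kappa delta / B) * enorm (grad f x) `^ (1 + tau / 2) * enorm w.
  rewrite mulrAC sqrtrM; last by rewrite divr_ge0// ltW.
  rewrite -(powR12_sqrt (powR_ge0 _ _)) -powRrM.
  rewrite powRD; last by rewrite gt_eqF// addr_gt0// divr_gt0.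
  by rewrite powRr1 ?ltW//; ring.
move=> /normalized_dot_bound hw.
rewrite yE addrAC subrr add0r enormN enormZ.
have gam_gt0 : 0 < gamma0 / 3 ^+ nn by rewrite divr_gt0// exprn_gt0.
move: arm; rewrite /armijo -yE gtr0_norm// => arm.
rewrite -lerN2 opprB; apply: le_trans arm _; rewrite mulNr lerN2.
rewrite [leRHS](_ : _ = (gamma0 / 3 ^+ nn) * (dot (normalized w) (grad f x)) / 3)//.
rewrite ler_pdivlMr//; apply: le_trans (ler_wpM2l (ltW gam_gt0) hw).
by rewrite le_eqVlt; apply/orP; left; apply/eqP; field.
Qed.

(** * Decrease and length of a BNQN step *)

(** The linearization at [xs] costs at most [c / 3] times [gam |wh|], and replacing the gradient at
    [xs] by that at [x] as much again. By the angle hypothesis these errors use up at most two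
    thirds of the predicted decrease. *)
Lemma armijo_short_step (R : realType) m (f : 'cV[R]_m -> R) (xs : 'cV[R]_m) (c : R) :
  C1 f -> 0 < c ->
  exists2 d, 0 < d & forall x wh gam, enorm (x - xs) < d -> 0 <= gam <= d ->
    enorm wh <= 1 -> c * enorm wh <= dot wh (grad f x) -> armijo f x wh gam.
Proof.
move=> f1 c0; have c3 : 0 < c / 3 by rewrite divr_gt0.
have [d1 d10 h1] := strictly_differentiable xs f1 c3.
have [d2 d20 h2] := grad_continuous xs f1 c3.
exists (Num.min d1 d2 / 2); first by rewrite divr_gt0// lt_min d10.
set d := Num.min d1 d2 / 2 => x wh gam xd /andP[gam0 gamd] wh1 angle.
have dd1 : d * 2 <= d1 by rewrite divfK ?pnatr_eq0// ge_min lexx.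
have dd2 : d * 2 <= d2 by rewrite divfK ?pnatr_eq0// ge_min lexx orbT.
have d0 : 0 <= d by exact: le_trans (enorm_ge0 _) (ltW xd).
have xd1 : enorm (x - xs) < d1 by lra.
have xd2 : enorm (x - xs) < d2 by lra.
have gw : enorm (- (gam *: wh)) = gam * enorm wh by rewrite enormN enormZ ger0_norm.
have yd1 : enorm (x - gam *: wh - xs) < d1.
  rewrite addrAC; apply: le_lt_trans (ler_enormD _ _) _; rewrite gw.
  have : gam * enorm wh <= d * 1 by rewrite ler_pM// enorm_ge0.
  lra.
have yx : x - gam *: wh - x = - (gam *: wh) by rewrite addrAC subrr add0r.
have := h1 _ _ xd1 yd1; rewrite yx gw dotC dotNl dotZl.
rewrite ler_norml => /andP[_ k1].
have := le_trans (ler_norm _) (Cauchy_Schwarz_dot wh (grad f x - grad f xs)).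
rewrite dotBr => k2.
have k3 : enorm wh * enorm (grad f x - grad f xs) <= enorm wh * (c / 3).
  by rewrite ler_wpM2l ?enorm_ge0//; exact: ltW (h2 _ xd2).
rewrite /armijo; move: k1 k2 k3 angle.
move: (f (x - _)) (f x) (dot wh (grad f xs)) (dot wh (grad f x)) (enorm wh)
  (enorm (grad f x - _)) => fy fx D0 D W Gd k1 k2 k3 angle.
have k4 : gam * (D - D0) <= gam * (W * (c / 3)) by rewrite ler_wpM2l// (le_trans k2).
have k5 : gam * (c * W) <= gam * D by rewrite ler_wpM2l.
nra.
Qed.

(** Either the first trial is accepted, or the previous trial, three times larger, was rejected and
    hence exceeds [d]. *)
Lemma backtracking_lower_bound (R : realType) (P : R -> Prop) (gamma0 d : R) nn :
  0 < gamma0 -> (forall k, (k < nn)%N -> ~ P (gamma0 / 3 ^+ k)) ->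
  (forall gam, 0 <= gam <= d -> P gam) -> Num.min gamma0 (d / 3) <= gamma0 / 3 ^+ nn.
Proof.
move=> g0 mini short; case: nn mini => [_|k mini].
  by rewrite expr0 divr1 ge_min lexx.
rewrite ge_min exprSr invfM mulrA ler_pM2r ?invr_gt0//; apply/orP; right.
rewrite leNgt; apply/negP => kd; apply: (mini k) => //; apply: short.
by rewrite (ltW kd) andbT divr_ge0 ?exprn_ge0// ltW.
Qed.

(** Where the gradient is at least [eta], the eigenvalues, the angle, the direction and the step
    size are all bounded away from 0; Armijo's condition then gives a fixed decrease. *)
Lemma bnqn_decrease_noncritical (R : realType) m (f : 'cV[R]_m -> R) delta tau gamma0
    (xs : 'cV[R]_m) :
  Ck 2 f -> injective delta -> 0 < tau -> 0 < gamma0 -> grad f xs <> 0 ->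
  exists2 r, 0 < r & exists2 c, 0 < c & forall x y, enorm (x - xs) < r ->
    bnqn_step f delta tau gamma0 x y -> f y + c <= f x.
Proof.
move=> f2 dinj t0 gam0 gs0; have f1 := Ck_C1 f2.
have k0 : 0 < kappa delta.
  apply: kappa_gt0 => //; rewrite lt0n; apply/eqP => m0; subst m.
  by apply: gs0; apply/colP => -[].
pose eta := enorm (grad f xs) / 2.
have eta0 : 0 < eta by rewrite divr_gt0// enorm_gt0; apply/eqP.
have [r1 r10 hg] := grad_continuous xs f1 eta0.
have [r2 r20 [B B0 hB]] := shiftA_locally_bounded delta xs f2 t0.
pose s := kappa delta * eta `^ tau.
have s0 : 0 < s by rewrite mulr_gt0// powR_gt0.
pose c1 := Num.sqrt (s / B) * eta.
have c10 : 0 < c1 by rewrite mulr_gt0// sqrtr_gt0 divr_gt0.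
have [r3 r30 harm] := armijo_short_step xs f1 c10.
(* From [|g|^2 <= B <w, g> <= B |w| |g|] follows [|w| >= eta / B]; the 1 accounts for the
   normalization. *)
pose b := Num.min 1 (eta / B).
have b0 : 0 < b by rewrite lt_min ltr01 divr_gt0.
have gm0 : 0 < Num.min gamma0 (r3 / 3) by rewrite lt_min gam0 divr_gt0.
exists (Num.min r1 (Num.min r2 r3)); first by rewrite !lt_min r10 r20.
exists (Num.min gamma0 (r3 / 3) * (c1 * b) / 3).
  by rewrite divr_gt0// mulr_gt0// mulr_gt0.
move=> x y; rewrite !lt_min => /andP[/hg xg /andP[xr2 xr3]] xy.
have geta : eta <= enorm (grad f x).
  have := ler_enorm_sub (grad f xs) (grad f x); rewrite enorm_distC.
  move: xg; rewrite /eta; lra.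
have gx0 := lt_le_trans eta0 geta.
have g0 : grad f x <> 0 by apply/eqP; rewrite -enorm_gt0.
have [j [w [nn [e [a [[_ yE arm mini] [Pars e1 Ae sa wg]]]]]]] := bnqn_stepP f2 dinj g0 xy.
have sa' i : s <= `|a i|.
  apply: le_trans (sa i); rewrite ler_pM2l// ge0_ler_powR ?nnegrE ?enorm_ge0// ltW//.
have aB i : `|a i| <= B by apply: eigenvalue_bound (e1 i) (Ae i) (hB _ _ _ xr2).
have h1 := direction_curvature Pars sa' wg.
have h2 := direction_gradient Pars aB wg.
have angle : c1 * enorm w <= dot w (grad f x).
  apply: le_trans (angle_bound s0 B0 h1 h2); rewrite /c1 mulrAC -mulrA.
  by rewrite ler_wpM2l ?sqrtr_ge0// ler_wpM2l ?enorm_ge0.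
have nangle := normalized_dot_bound angle.
have wb : eta / B <= enorm w.
  rewrite ler_pdivrMr//; apply: le_trans geta _.
  rewrite -(ler_pM2l gx0) -expr2; apply: le_trans h2 _.
  rewrite [leRHS](_ : _ = B * (enorm w * enorm (grad f x))); last by ring.
  rewrite ler_pM2l//.
  exact: le_trans (ler_norm _) (Cauchy_Schwarz_dot _ _).
have nb : b <= enorm (normalized w).
  apply: enorm_normalized_ge; rewrite ?(ltW b0)// ge_min ?lexx//.
  by rewrite wb orbT.
have gamb : Num.min gamma0 (r3 / 3) <= gamma0 / 3 ^+ nn.
  apply: backtracking_lower_bound mini _ => // gam hgam.
  exact: harm (enorm_normalized_le1 _) nangle.
move: arm; rewrite /armijo -yE => arm.
have k1 : c1 * b <= dot (normalized w) (grad f x).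
  by apply: le_trans nangle; rewrite ler_pM2l.
have k2 : Num.min gamma0 (r3 / 3) * (c1 * b) <=
    gamma0 / 3 ^+ nn * dot (normalized w) (grad f x).
  by rewrite ler_pM// ltW// mulr_gt0.
move: arm k2; rewrite mulNr; move: (_ * (c1 * b)) (_ * dot _ _) (f y) (f x) => X1 X2 X3 X4; lra.
Qed.

(** Bolzano-Weierstrass along the indices satisfying [P]: the tails of this subsequence generate a
    proper filter, and it contains a compact cube. Transposes appear because compactness of cubes is
    taken for row vectors. *)
Lemma bounded_cluster_point (R : realType) n (x : nat -> 'cV[R]_n) (P : nat -> Prop) (M : R) :
  (forall N, exists2 k, (N <= k)%N & P k) -> (forall k, P k -> enorm (x k) <= M) ->
  exists y, forall e N, 0 < e -> exists k, [/\ (N <= k)%N, P k & enorm (x k - y) < e].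
Proof.
move=> Pinf xM.
pose F : set_system 'rV[R]_n :=
  [set S : set 'rV[R]_n | exists N, forall k, (N <= k)%N -> P k -> S (x k)^T]%classic.
have FF : ProperFilter F.
  apply: Build_ProperFilter => [[N h]|].
    by have [k Nk Pk] := Pinf N; exact: h Nk Pk.
  split=> [|A B [N1 h1] [N2 h2]|A B AB [N h]].
  - by exists 0%N.
  - exists (maxn N1 N2) => k; rewrite geq_max => /andP[k1 k2] Pk.
    by split; [exact: h1|exact: h2].
  - by exists N => k Nk Pk; apply/AB/h.
have cK := @rV_compact R n (fun=> `[- M, M]%classic) (fun=> @segment_compact R _ _).
have FK : F [set v : 'rV[R]_n | forall i, `[- M, M]%classic (v ord0 i)]%classic.
  exists 0%N => k _ Pk i; rewrite /= in_itv/= mxE -ler_norml.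
  exact: le_trans (ler_norm_coord _ _) (xM k Pk).
have [y [_ cy]] := cK F FF FK.
exists y^T => e N e0.
have e1 : 0 < e / n.+1%:R by rewrite divr_gt0.
have FA : F [set v | exists k, [/\ (N <= k)%N, P k & v = (x k)^T]]%classic.
  by exists N => k Nk Pk; exists k.
have [v [[k [Nk Pk ->]] hv]] := cy _ _ FA (nbhsx_ballx y _ e1).
exists k; split=> //; apply: le_lt_trans (ler_enorm_sum _) _.
apply: le_lt_trans (sum_const_fraction_lt n e0); apply: ler_sum => i _.
have [_ /(_ ord0 i)] := hv; rewrite -ball_normE/= !mxE distrC => h.
exact: ltW h.
Qed.

Lemma powR_small (R : realType) (b eta : R) : 0 < b -> 0 < eta ->
  exists2 t0, 0 < t0 & forall t, 0 <= t < t0 -> t `^ b < eta.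
Proof.
move=> b0 e0; exists (eta `^ b^-1); first exact: powR_gt0.
move=> t /andP[t0 tt]; have -> : eta = (eta `^ b^-1) `^ b.
  by rewrite -powRrM mulVf ?gt_eqF// powRr1// ltW.
by apply: gt0_ltr_powR; rewrite ?nnegrE ?powR_ge0.
Qed.

Lemma powR_exponent_le (R : realType) (t a b : R) : 0 <= t <= 1 -> 0 < a <= b ->
  t `^ b <= t `^ a.
Proof.
move=> /andP[t0 t1] /andP[a0 ab]; move: t0; rewrite le_eqVlt => /predU1P[<-|t0].
  by rewrite !powR0// gt_eqF// (lt_le_trans a0).
by apply: ger_powR => //; rewrite t0.
Qed.

(** Compactness of the unit sphere, by contradiction. Counterexamples at radius [1 / (k + 1)], with
    exponents tending to 1 and constants tending to infinity, have unit vectors clustering at some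
    [es]; they violate the gradient inequality of [gradF f] at [(xs, es)], where its value is 0. *)
Lemma grad_loj_uniform (R : realType) m (f : 'cV[R]_m -> R) (xs : 'cV[R]_m) :
  Ck 2 f -> grad f xs = 0 -> grad_loj f ->
  exists r mu C, [/\ 0 < r, 0 < mu < 1, 0 < C &
    forall x e, enorm (x - xs) < r -> enorm e = 1 ->
      `|dot (grad f x) e| `^ mu <= C * (enorm (hessian f x *m e) + enorm (grad f x))].
Proof.
move=> f2 gs0 floj; apply: contrapT => H.
pose mu k : R := 1 - k.+2%:R^-1.
have mu01 k : 0 < mu k < 1.
  rewrite /mu subr_gt0 invf_lt1// ltr1n/=.
  by rewrite ltrBlDr ltrDl invr_gt0.
have bad k : exists xe : 'cV[R]_m * 'cV[R]_m,
    [/\ enorm (xe.1 - xs) < k.+1%:R^-1, enorm xe.2 = 1 &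
     k.+1%:R * (enorm (hessian f xe.1 *m xe.2) + enorm (grad f xe.1)) <
     `|dot (grad f xe.1) xe.2| `^ mu k].
  apply: contrapT => H2; apply: H; exists k.+1%:R^-1, (mu k), k.+1%:R.
  split=> // x e xr e1.
  rewrite leNgt; apply/negP => lt; apply: H2; exists (x, e); split=> //.
have [xe xeP] := @boolp.choice _ _ _ bad.
have [es esP] : exists y, forall e N, 0 < e ->
    exists k, [/\ (N <= k)%N, True & enorm ((xe k).2 - y) < e].
  apply: (@bounded_cluster_point _ _ (fun k => (xe k).2) (fun=> True) 1).
    by move=> N; exists N.
  by move=> k _; have [_ -> _] := xeP k.
have [r [nu [C [r0 nu01 C0 hloj]]]] := floj (col_mx xs es).
have [d d0 hg] := grad_continuous xs (Ck_C1 f2) ltr01.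
have /andP[nu0 nu1] := nu01.
have nu2 : 0 < 1 - nu by rewrite subr_gt0.
(* An index beyond [T] meets all four requirements: closeness in [r], gradient at most 1, exponent
   [mu k] at least [nu], and constant above [C]. *)
pose T := 2 / r + d^-1 + (1 - nu)^-1 + C.
have T0 : 0 <= T by rewrite !addr_ge0 ?divr_ge0 ?invr_ge0// ltW.
have [k [Nk _ esk]] := esP (r / 2) (Num.bound T) (divr_gt0 r0 (ltr0n _ 2)).
have Tk : T < k.+1%:R.
  apply: lt_le_trans (archi_boundP T0) _.
  by rewrite ler_nat (leq_trans Nk).
have rk : 2 / r < k.+1%:R.
  apply: le_lt_trans Tk; rewrite /T -!addrA lerDl !addr_ge0 ?invr_ge0// ltW//.
have dk : d^-1 < k.+1%:R.
  apply: le_lt_trans Tk; rewrite /T -!addrA addrCA lerDl !addr_ge0 ?invr_ge0 ?divr_ge0// ltW//.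
have nk : (1 - nu)^-1 < k.+1%:R.
  apply: le_lt_trans Tk; rewrite /T addrAC addrC lerDl !addr_ge0 ?invr_ge0 ?divr_ge0// ltW//.
have Ck' : C < k.+1%:R.
  apply: le_lt_trans Tk; rewrite /T addrC lerDl !addr_ge0 ?invr_ge0 ?divr_ge0// ltW//.
have [] := xeP k; case: (xe k) esk => x e /= esk xk e1 viol.
have k10 : 0 < k.+1%:R :> R by [].
have kr : k.+1%:R^-1 < r / 2 by rewrite invf_plt ?posrE ?divr_gt0// invf_div.
have kd : k.+1%:R^-1 < d by rewrite invf_plt ?posrE.
have knu : nu <= mu k.
  rewrite /mu lerBrDr addrC -lerBrDr; apply: ltW; rewrite invf_plt ?posrE//.
  by apply: lt_trans nk _; rewrite ltr_nat.
have g1 : enorm (grad f x) <= 1.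
  by have := hg x (lt_trans xk kd); rewrite gs0 subr0 => /ltW.
have near : enorm (col_mx x e - col_mx xs es) < r.
  rewrite opp_col_mx add_col_mx; apply: le_lt_trans (enorm_col_mx _ _) _.
  have := lt_trans xk kr; lra.
have := hloj _ near; rewrite grad_gradF// /gradF !col_mxKu !col_mxKd gs0 dot0l subr0.
move=> h; have {}h := le_trans h (ler_wpM2l (ltW C0) (enorm_col_mx _ _)).
(* On [[0, 1]] a larger exponent gives a smaller power, so the violation at exponent [mu k] persists
   at [nu]. *)
have de1 : 0 <= `|dot (grad f x) e| <= 1.
  rewrite normr_ge0/=; apply: le_trans (Cauchy_Schwarz_dot _ _) _.
  by rewrite e1 mulr1.
have := lt_le_trans viol (le_trans (powR_exponent_le de1 _) h).
rewrite nu0 knu => /(_ isT); rewrite ltNge => /negP; apply.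
by rewrite ler_wpM2r ?addr_ge0 ?enorm_ge0// ltW.
Qed.

(** The point is [|g_i|^mu <= K |a_i|], which gives [|w_i| = |g_i| / |a_i| <= K |g_i|^(1 - mu)], a
    quantity vanishing with the gradient. *)
Lemma bnqn_step_small (R : realType) m (f : 'cV[R]_m -> R) delta tau gamma0
    (xs : 'cV[R]_m) (eps : R) :
  Ck 2 f -> injective delta -> 0 < tau <= 1 -> 0 < gamma0 < 1 ->
  grad f xs = 0 -> grad_loj f -> 0 < eps ->
  exists2 r, 0 < r & forall x y, enorm (x - xs) < r ->
    bnqn_step f delta tau gamma0 x y -> enorm (y - x) < eps.
Proof.
move=> f2 dinj /andP[t0 t1] /andP[gam0 gam1] gs0 floj eps0.
have [k0|k0] := leP (kappa delta) 0.
  exists 1 => // x y xr xy; have [g0|/eqP g0] := eqVneq (grad f x) 0.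
    by rewrite (bnqn_step_critical g0 xy) subrr enorm0.
  have [j [w [nn [e [a [[]]]]]]] := bnqn_stepP f2 dinj g0 xy.
  by rewrite ltNge k0.
have [r1 [mu [C [r10 /andP[mu0 mu1] C0 hloj]]]] := grad_loj_uniform f2 gs0 floj.
pose D := \sum_j `|delta j|.
have D0 : 0 <= D by exact: sumr_ge0.
(* The three terms come from [|H e_i| <= |a_i| + D |g|^tau] and [|g| <= |g|^tau], with
   [|g|^tau <= |a_i| / kappa]. *)
pose K := C * (1 + D / kappa delta + (kappa delta)^-1).
have K0 : 0 < K.
  have ik0 : 0 <= (kappa delta)^-1 by rewrite invr_ge0 ltW.
  by rewrite mulr_gt0// -addrA ltr_pwDl// addr_ge0// mulr_ge0.
have mu2 : 0 < 1 - mu by rewrite subr_gt0.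
have etaK : 0 < eps / (K * m.+1%:R) by rewrite divr_gt0// mulr_gt0.
have [t tp ht] := powR_small mu2 etaK.
have mt0 : 0 < Num.min 1 t by rewrite lt_min ltr01.
have [r2 r20 hg] := grad_continuous xs (Ck_C1 f2) mt0.
exists (Num.min r1 r2); first by rewrite lt_min r10.
move=> x y; rewrite lt_min => /andP[xr1 xr2] xy.
have [g0|/eqP g0] := eqVneq (grad f x) 0.
  by rewrite (bnqn_step_critical g0 xy) subrr enorm0.
have [j [w [nn [e [a [[_ yE _ _] [Pars e1 Ae sa wg]]]]]]] := bnqn_stepP f2 dinj g0 xy.
have gx0 : 0 < enorm (grad f x) by rewrite enorm_gt0; apply/eqP.
have := hg x xr2; rewrite gs0 subr0 lt_min => /andP[g1 gt].
(* Here [tau <= 1] enters, together with [|g| <= 1]. *)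
have ggn : enorm (grad f x) <= enorm (grad f x) `^ tau.
  by rewrite ger1_powR// gx0 ltW.
have He i : enorm (hessian f x *m e i) <= `|a i| + D * enorm (grad f x) `^ tau.
  have -> : hessian f x *m e i = (a i - delta j * enorm (grad f x) `^ tau) *: e i.
    by rewrite scalerBl -Ae mulmxDl mul_scalar_mx addrK.
  rewrite enormZ e1 mulr1; apply: le_trans (ler_normB _ _) _.
  rewrite lerD2l normrM (ger0_norm (powR_ge0 _ _)) ler_wpM2r ?powR_ge0//.
  by rewrite /D (bigD1 j)//= lerDl sumr_ge0.
have gK i : `|dot (grad f x) (e i)| `^ mu <= K * `|a i|.
  apply: le_trans (hloj _ _ xr1 (e1 i)) _; rewrite /K -mulrA ler_pM2l//.
  have gna : enorm (grad f x) `^ tau <= (kappa delta)^-1 * `|a i|.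
    by rewrite mulrC ler_pdivlMr// mulrC sa.
  have Dgna := ler_wpM2l D0 gna.
  have := He i; rewrite !mulrDl mul1r -mulrA.
  move: gna Dgna ggn; move: (enorm (hessian f x *m _)) => ? ? ? ? ?; lra.
have wK i : `|dot w (e i)| <= K * enorm (grad f x) `^ (1 - mu).
  have ai0 : 0 < `|a i| by apply: lt_le_trans (sa i); rewrite mulr_gt0// powR_gt0.
  have [gi0|gi0] := eqVneq (dot (grad f x) (e i)) 0.
    have := wg i; rewrite gi0 => /eqP; rewrite mulf_eq0 (gt_eqF ai0) orbF => /eqP ->.
    by rewrite normr0 mulr_ge0 ?powR_ge0// ltW.
  have gi : 0 < `|dot (grad f x) (e i)| by rewrite normr_gt0.
  have gip : 0 < `|dot (grad f x) (e i)| `^ mu by exact: powR_gt0.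
  have h : `|dot w (e i)| <= K * `|dot (grad f x) (e i)| `^ (1 - mu).
    rewrite -(ler_pM2l gip) mulrCA -powRD; last by rewrite subrKC oner_eq0.
    rewrite subrKC powRr1//.
    rewrite -{2}wg normrM normr_id mulrCA [leLHS]mulrC ler_wpM2l//.
  apply: le_trans h _; rewrite ler_pM2l//; apply: ge0_ler_powR; rewrite ?nnegrE ?enorm_ge0 ?(ltW mu2)//.
  by apply: le_trans (Cauchy_Schwarz_dot _ _) _; rewrite e1 mulr1.
have wL : enorm w < eps.
  have Lb : K * m.+1%:R * enorm (grad f x) `^ (1 - mu) < eps.
    have KM : 0 < K * m.+1%:R by rewrite mulr_gt0.
    by rewrite mulrC -(ltr_pdivlMr _ _ KM); apply: ht; rewrite enorm_ge0.
  apply: le_lt_trans Lb.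
  have KG : 0 <= K * m.+1%:R * enorm (grad f x) `^ (1 - mu).
    exact: mulr_ge0 (mulr_ge0 (ltW K0) (ler0n _ _)) (powR_ge0 _ _).
  rewrite -(ler_pXn2r (_ : 0 < 2)%N) ?nnegrE ?enorm_ge0//.
  rewrite sqr_enorm Pars.
  apply: le_trans (_ : \sum_(i < m) (K * enorm (grad f x) `^ (1 - mu)) ^+ 2 <= _).
    apply: ler_sum => i _; rewrite -expr2 -[leLHS]real_normK ?num_real//.
    by rewrite ler_pXn2r ?nnegrE// mulr_ge0 ?powR_ge0// ltW.
  rewrite sumr_const card_ord -[leLHS]mulr_natr [K * m.+1%:R * _]mulrAC [leRHS]exprMn.
  rewrite ler_wpM2l ?sqr_ge0// -natrX ler_nat.
  by rewrite (leq_trans (leqnSn m))// -{1}(expn1 m.+1) leq_pexp2l.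
rewrite yE addrAC subrr add0r enormN enormZ.
have gp : 0 < gamma0 / 3 ^+ nn by rewrite divr_gt0// exprn_gt0.
apply: le_lt_trans wL; rewrite gtr0_norm// -[leRHS]mul1r ler_pM ?enorm_ge0 ?(ltW gp)//.
  rewrite ler_pdivrMr ?exprn_gt0// mul1r (le_trans (ltW gam1))//.
  by rewrite exprn_ege1// ler1n.
exact: enorm_normalized_le.
Qed.

(** * Convergence *)

Definition cluster_point (R : realType) n (x : nat -> 'cV[R]_n) (y : 'cV[R]_n) :=
  forall (e : R) N, 0 < e -> exists2 k, (N <= k)%N & enorm (x k - y) < e.

Lemma diverges_or_cluster (R : realType) n (x : nat -> 'cV[R]_n) :
  diverges x \/ exists y, cluster_point x y.
Proof.
apply: contrapT => /not_orP[/existsNP[M h] nocl]; apply: nocl.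
have Pinf N : exists2 k, (N <= k)%N & enorm (x k) <= M.
  apply: contrapT => nk; apply: h; exists N => k Nk; rewrite ltNge; apply/negP => kM.
  by apply: nk; exists k.
have [y hy] := bounded_cluster_point Pinf (fun k h => h).
by exists y => e N /(hy e N)[k [Nk _ ke]]; exists k.
Qed.

Section descent.
Variables (R : realType) (m : nat) (f : 'cV[R]_m -> R) (delta : 'I_m.+1 -> R).
Variables (tau gamma0 : R) (x : nat -> 'cV[R]_m).
Hypotheses (f2 : Ck 2 f) (dinj : injective delta) (tau0 : 0 < tau) (gam0 : 0 < gamma0).
Hypothesis xP : bnqn_seq f delta tau gamma0 x.

(** The local decrease estimate is applied with each iterate as its own centre. *)
Lemma bnqn_nonincreasing k n : (k <= n)%N -> f (x n) <= f (x k).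
Proof.
move=> /subnK <-; elim: (n - k)%N => [|i IH]; first by rewrite add0n.
apply: le_trans IH; rewrite addSn -subr_ge0.
have [r r0 [c c0 h]] := bnqn_sufficient_decrease (x (i + k)) f2 dinj tau0 gam0.
apply: le_trans (h _ _ _ (xP (i + k))); last by rewrite subrr enorm0.
by rewrite !mulr_ge0 ?powR_ge0 ?enorm_ge0// ltW.
Qed.

(** Continuity controls [f] at one visit near [xs]; monotonicity extends the bound to all later
    indices. *)
Lemma bnqn_cluster_value xs (e : R) : cluster_point x xs -> 0 < e ->
  exists N, forall n, (N <= n)%N -> f (x n) - f xs < e.
Proof.
move=> clx e0; have [d d0 h] := (Ck_econt f2 : econt f) xs e e0.
have [k _ /h kx] := clx d 0%N d0; exists k => n kn.
apply: le_lt_trans kx; apply: le_trans (ler_norm _).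
by rewrite lerD2r bnqn_nonincreasing.
Qed.

Lemma bnqn_cluster_lower xs n : cluster_point x xs -> f xs <= f (x n).
Proof.
move=> clx; rewrite leNgt; apply/negP => lt.
have e0 : 0 < f xs - f (x n) by rewrite subr_gt0.
have [d d0 h] := (Ck_econt f2 : econt f) xs _ e0.
have [k nk /h] := clx d n d0; rewrite distrC => kx.
have := le_lt_trans (ler_norm _) kx; rewrite ltrD2l ltrN2 ltNge.
by rewrite bnqn_nonincreasing.
Qed.

(** Near a noncritical cluster point a step lowers [f] by a fixed [c], but eventually [f (x n)]
    exceeds its lower bound [f xs] by less than [c]. *)
Lemma bnqn_cluster_critical xs : cluster_point x xs -> critical f xs.
Proof.
move=> clx; apply: contrapT => g0.
have [r r0 [c c0 h]] := bnqn_decrease_noncritical f2 dinj tau0 gam0 g0.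
have [N hN] := bnqn_cluster_value clx c0.
have [k Nk kr] := clx r N r0.
have := h _ _ kr (xP k); have := hN k Nk; have := bnqn_cluster_lower k.+1 clx; lra.
Qed.

End descent.

(** The step bound holds only inside the ball, so it has to be shown that the sequence stays there.
    Starting at an [N] with [x N] within [e' / 2] of [xs] and [K * psi N < e' / 2], the telescoped
    length is too short to leave. *)
Lemma summable_steps_converge (R : realType) n (x : nat -> 'cV[R]_n) xs (psi : nat -> R) (r K : R) :
  0 < r -> 0 < K -> (forall k, 0 <= psi k) ->
  (forall e, 0 < e -> exists N, forall k, (N <= k)%N -> psi k < e) ->
  (forall k, enorm (x k - xs) < r -> enorm (x k.+1 - x k) <= K * (psi k - psi k.+1)) ->
  cluster_point x xs -> converges_to x xs.
Proof.
move=> r0 K0 psi0 psicvg step clx e e0.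
pose e' := Num.min e r; have e'0 : 0 < e' by rewrite lt_min e0.
have [N0 hN0] := psicvg (e' / 2 / K) (divr_gt0 (divr_gt0 e'0 (ltr0n _ 2)) K0).
have [N NN0 xN] := clx (e' / 2) N0 (divr_gt0 e'0 (ltr0n _ 2)).
have psiN : K * psi N < e' / 2 by rewrite mulrC -ltr_pdivlMr// hN0.
have key i : enorm (x (i + N)%N - x N) <= K * (psi N - psi (i + N)%N) /\
    enorm (x (i + N)%N - xs) < e'.
  have imp j : enorm (x (j + N)%N - x N) <= K * (psi N - psi (j + N)%N) ->
      enorm (x (j + N)%N - xs) < e'.
    move=> h; apply: le_lt_trans (ler_enorm_dist _ (x N) _) _.
    have : 0 <= K * psi (j + N)%N by rewrite mulr_ge0// ltW.
    move: h; rewrite mulrBr; lra.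
  suff : enorm (x (i + N)%N - x N) <= K * (psi N - psi (i + N)%N).
    by move=> h; split=> //; exact: imp.
  elim: i => [|i IH]; first by rewrite add0n !subrr enorm0 mulr0.
  apply: le_trans (ler_enorm_dist _ (x (i + N)%N) _) _; rewrite addSn.
  have := step (i + N)%N (lt_le_trans (imp i IH) _).
  rewrite ge_min lexx orbT => /(_ isT); move: IH; rewrite !mulrBr; lra.
exists N => k Nk; have [_] := key (k - N)%N; rewrite subnK// => h.
by apply: lt_le_trans h _; rewrite ge_min lexx.
Qed.

(** Concavity of the power [s], obtained from Young's inequality
    [b^s a^(1 - s) <= s b + (1 - s) a]. *)
Lemma powR_tangent (R : realType) (a b s : R) : 0 < a -> 0 <= b -> 0 < s < 1 ->
  s * (a - b) <= a `^ (1 - s) * (a `^ s - b `^ s).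
Proof.
move=> a0 b0 /andP[s0 s1]; have t0 : 0 < 1 - s by rewrite subr_gt0.
have := @conjugate_powR R (b `^ s) (a `^ (1 - s)) s^-1 (1 - s)^-1.
rewrite !powR_ge0 !invr_gt0 s0 t0 !invrK addrC subrK -!powRrM.
rewrite !mulfV ?gt_eqF// !powRr1// ?(ltW a0)// => /(_ isT isT isT isT erefl) h.
rewrite [leRHS]mulrBr -powRD; last by rewrite subrK oner_eq0.
by rewrite subrK powRr1 ?(ltW a0)//; lra.
Qed.

(** With [nu = 1 + tau / 2], the gradient inequality bounds [(f x - f xs)^(mu nu)] by [C^nu |g|^nu].
    This is the prefactor in [powR_tangent], so [|g|^nu] cancels against the sufficient decrease. *)
Lemma loj_step_length (R : realType) m (f : 'cV[R]_m -> R) delta tau gamma0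
    (xs : 'cV[R]_m) (r mu C : R) :
  Ck 2 f -> injective delta -> 0 < tau -> 0 < gamma0 ->
  0 < r -> 0 < mu -> 0 < C -> mu * (1 + tau / 2) < 1 ->
  (forall x, enorm (x - xs) < r -> `|f x - f xs| `^ mu <= C * enorm (grad f x)) ->
  exists2 r', 0 < r' & exists2 K, 0 < K & forall x y, enorm (x - xs) < r' ->
    bnqn_step f delta tau gamma0 x y -> f xs <= f y -> f y <= f x ->
    enorm (y - x) <= K * ((f x - f xs) `^ (1 - mu * (1 + tau / 2))
                          - (f y - f xs) `^ (1 - mu * (1 + tau / 2))).
Proof.
move=> f2 dinj t0 gam0 r0 mu0 C0; set nu := 1 + tau / 2 => munu hloj.
have nu0 : 0 < nu by rewrite addr_gt0// divr_gt0.
have [r1 r10 [c c0 hdec]] := bnqn_sufficient_decrease xs f2 dinj t0 gam0.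
set s := 1 - mu * nu.
have s0 : 0 < s by rewrite subr_gt0.
have s1 : s < 1 by rewrite ltrBlDr ltrDl mulr_gt0.
have Cnu0 : 0 < C `^ nu by exact: powR_gt0.
exists (Num.min r r1); first by rewrite lt_min r0.
exists (C `^ nu / (c * s)); first by rewrite divr_gt0// mulr_gt0.
move=> x y; rewrite lt_min => /andP[/hloj lx xr1] xy fy fyx.
have dec := hdec _ _ xr1 xy.
have [g0|/eqP g0] := eqVneq (grad f x) 0.
  by rewrite (bnqn_step_critical g0 xy) !subrr enorm0 mulr0.
have gx0 : 0 < enorm (grad f x) by rewrite enorm_gt0; apply/eqP.
have phi0 : 0 <= f x - f xs by rewrite subr_ge0 (le_trans fy).
move: lx; rewrite ger0_norm// => lx.
have : 0 <= f y - f xs by rewrite subr_ge0.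
have {dec} : c * enorm (grad f x) `^ nu * enorm (y - x) <= (f x - f xs) - (f y - f xs).
  by apply: le_trans dec _; rewrite le_eqVlt; apply/orP; left; apply/eqP; ring.
have {lx} : (f x - f xs) `^ (mu * nu) <= C `^ nu * enorm (grad f x) `^ nu.
  rewrite powRrM -powRM ?enorm_ge0 ?(ltW C0)//.
  by apply: ge0_ler_powR; rewrite ?nnegrE ?(ltW nu0) ?powR_ge0// mulr_ge0 ?enorm_ge0// ltW.
have Gnu0 : 0 < enorm (grad f x) `^ nu by exact: powR_gt0.
have D0 := enorm_ge0 (y - x).
move: phi0 Gnu0 D0; move: (f x - f xs) (f y - f xs) => phi psi.
move: (enorm (y - x)) (enorm (grad f x) `^ nu) => d G phi0 G0 d0 k1 k2 psi0.
(* [powR_tangent] requires [phi > 0]; if [phi = 0], no decrease is left and the step is zero. *)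
move: phi0; rewrite le_eqVlt => /predU1P[phi0|phi0].
  subst phi; have psi00 : psi = 0.
    have : 0 <= c * G * d by rewrite !mulr_ge0// ltW.
    lra.
  rewrite psi00 subrr mulr0; move: k2; rewrite psi00 subrr.
  by rewrite pmulr_rle0// mulr_gt0.
have := powR_tangent phi0 psi0 (_ : 0 < s < 1); rewrite s0 s1 => /(_ isT).
have -> : 1 - s = mu * nu by rewrite /s opprB addrC subrK.
move=> k3.
have pn0 : 0 < phi `^ (mu * nu) by exact: powR_gt0.
have E0 : 0 <= phi `^ s - psi `^ s.
  rewrite -(pmulr_rge0 _ pn0); apply: le_trans k3; rewrite mulr_ge0 ?(ltW s0)//.
  by apply: le_trans k2; rewrite !mulr_ge0// ltW.
rewrite mulrAC ler_pdivlMr ?mulr_gt0//.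
have k4 : s * (c * G * d) <= (C `^ nu * G) * (phi `^ s - psi `^ s).
  apply: le_trans (le_trans k3 _); first by rewrite ler_pM2l.
  by rewrite ler_wpM2r.
rewrite -(ler_pM2l G0); move: k4; move: (_ - _) (C `^ nu) => E Cn k4.
by apply: le_trans (le_trans k4 _); rewrite le_eqVlt; apply/orP; left; apply/eqP; ring.
Qed.

Lemma loj_cluster_converges (R : realType) m (f : 'cV[R]_m -> R) delta tau gamma0
    (x : nat -> 'cV[R]_m) (xs : 'cV[R]_m) (r mu C : R) :
  Ck 2 f -> injective delta -> 0 < tau -> 0 < gamma0 ->
  bnqn_seq f delta tau gamma0 x -> cluster_point x xs ->
  0 < r -> 0 < mu -> 0 < C -> mu * (1 + tau / 2) < 1 ->
  (forall x, enorm (x - xs) < r -> `|f x - f xs| `^ mu <= C * enorm (grad f x)) ->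
  converges_to x xs.
Proof.
move=> f2 dinj t0 gam0 xP clx r0 mu0 C0 munu hloj.
have [r1 r10 [K K0 h]] := loj_step_length f2 dinj t0 gam0 r0 mu0 C0 munu hloj.
have flow k := bnqn_cluster_lower f2 dinj t0 gam0 xP k clx.
have s0 : 0 < 1 - mu * (1 + tau / 2) by rewrite subr_gt0.
apply: (summable_steps_converge r10 K0 _ _ _ clx) => [k|e e0|k kr].
- exact: (powR_ge0 (f (x k) - f xs) (1 - mu * (1 + tau / 2))).
- have [t tp ht] := powR_small s0 e0.
  have [N hN] := bnqn_cluster_value f2 dinj t0 gam0 xP clx tp.
  by exists N => k Nk; apply: ht; rewrite subr_ge0 flow hN.
- apply: h kr (xP k) (flow _) _.
  exact: (bnqn_nonincreasing f2 dinj t0 gam0 xP (leqnSn k)).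
Qed.

(** The interval has positive Lebesgue measure, whereas the range of [u] is a null set. *)
Lemma countable_avoid (R : realType) (u : nat -> R) (e : R) : 0 < e ->
  exists2 rho, 0 < rho < e & forall k, u k != rho.
Proof.
move=> e0; apply: contrapT => H.
have sub : (`]0, e[ `<=` range u)%classic.
  move=> t /=; rewrite in_itv/= => te; apply: contrapT => nt; apply: H; exists t => // k.
  by apply/eqP => ut; apply: nt; exists k.
have cI : countable (`]0, e[%classic : set R).
  apply: sub_countable (subset_card_le sub) _.
  exact: sub_countable (card_image_le _ _) (countableP _).
have := countable_lebesgue_measure0 cI.
rewrite lebesgue_measure_itv/= lte_fin e0 oppr0 adde0 => -[e00].
by rewrite e00 ltxx in e0.
Qed.

Lemma infinitely_many_crossings (Q : nat -> Prop) :
  (forall N, exists2 n, (N <= n)%N & Q n) -> (forall N, exists2 n, (N <= n)%N & ~ Q n) ->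
  forall N, exists2 n, (N <= n)%N & Q n /\ ~ Q n.+1.
Proof.
move=> Qinf nQinf N; have [a Na Qa] := Qinf N; have [b ab nQb] := nQinf a.
move: nQb; rewrite -(subnK ab); elim: (b - a)%N => [|i IH]; first by rewrite add0n.
rewrite addSn => nQ; have [Qi|/IH//] := pselect (Q (i + a)%N).
by exists (i + a)%N => //; rewrite (leq_trans Na) ?leq_addl.
Qed.

(** Without convergence the sequence leaves infinitely often a ball around [xs] whose sphere carries
    no cluster point. The last points before the exits cluster strictly inside the ball, where the
    vanishing steps are too short to get out. *)
Lemma vanishing_steps_converge (R : realType) n (x : nat -> 'cV[R]_n) xs (h : nat -> 'cV[R]_n) :
  (forall y, cluster_point x y -> exists k, h k = y) ->
  (forall y e, cluster_point x y -> 0 < e -> exists2 r, 0 < r &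
     forall k, enorm (x k - y) < r -> enorm (x k.+1 - x k) < e) ->
  cluster_point x xs -> converges_to x xs.
Proof.
move=> hcl small clx e e0; apply: contrapT => ncvg.
have [rho /andP[rho0 rhoe] rhoh] := countable_avoid (fun k => enorm (h k - xs)) e0.
have out N : exists2 k, (N <= k)%N & ~ (enorm (x k - xs) < rho).
  apply: contrapT => H; apply: ncvg; exists N => k Nk; apply: contrapT => ke.
  by apply: H; exists k => // lt; apply: ke; exact: lt_trans rhoe.
have cross := infinitely_many_crossings (fun N => clx rho N rho0) out.
have bnd k : enorm (x k - xs) < rho /\ ~ (enorm (x k.+1 - xs) < rho) ->
    enorm (x k) <= rho + enorm xs.
  by move=> [lt _]; apply: le_trans (ler_enorm_sub _ xs) _; rewrite lerD2r ltW.
have [y hy] := bounded_cluster_point cross bnd.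
have cly : cluster_point x y.
  by move=> d N /(hy d N)[k [Nk _ kd]]; exists k.
have yrho : enorm (y - xs) < rho.
  rewrite lt_neqAle; apply/andP; split.
    by have [k <-] := hcl y cly; exact: rhoh.
  rewrite leNgt; apply/negP => lt.
  have := hy (enorm (y - xs) - rho) 0%N; rewrite subr_gt0 => /(_ lt)[k [_ [kr _] ky]].
  have := ler_enorm_dist y (x k) xs; rewrite (enorm_distC y (x k)); lra.
(* Half the gap to the sphere: one half for the distance from [x k] to [y], the other for the
   step. *)
pose d := (rho - enorm (y - xs)) / 2.
have d0 : 0 < d by rewrite divr_gt0// subr_gt0.
have [r r0 hr] := small y d cly d0.
have mr0 : 0 < Num.min r d by rewrite lt_min r0.
have [k [_ [_ kout]]] := hy (Num.min r d) 0%N mr0.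
rewrite lt_min => /andP[/hr kstep kd]; apply: kout.
apply: le_lt_trans (ler_enorm_dist _ (x k) _) _.
have := ler_enorm_dist (x k) y xs; move: kstep kd; rewrite /d; lra.
Qed.

(** The infimum may not be attained, but admissible exponents come arbitrarily close to it. [loj_at]
    makes the set nonempty, so that [inf] is a true infimum. *)
Lemma loj_exponent_witness (R : realType) n (g : 'cV[R]_n -> R) (xs : 'cV[R]_n) (b : R) :
  loj_at g xs -> loj_exponent g xs < b ->
  exists mu r C, [/\ 0 < mu, mu < b, 0 < r, 0 < C &
    forall x, enorm (x - xs) < r -> `|g x - g xs| `^ mu <= C * enorm (grad g x)].
Proof.
move=> [r [mu [C [r0 /andP[mu0 _] C0 h]]]] lt.
have b0 : 0 < b - loj_exponent g xs by rewrite subr_gt0.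
pose E := [set mu : R | 0 < mu /\ exists r C, [/\ 0 < r, 0 < C &
    forall x, enorm (x - xs) < r -> `|g x - g xs| `^ mu <= C * enorm (grad g x)]]%classic.
have infE : has_inf E.
  split; first by exists mu; split=> //; exists r, C.
  by exists 0 => nu [/ltW].
have [nu [nu0 [r' [C' [r'0 C'0 h']]]] nub] := inf_adherent b0 infE.
exists nu, r', C'; split=> //.
by move: nub; rewrite -/(loj_exponent g xs) subrKC.
Qed.

Theorem theorem2 (R : realType) (m : nat) (f : 'cV[R]_m -> R)
    (delta : 'I_m.+1 -> R) (tau gamma0 : R) (x : nat -> 'cV[R]_m) :
  Ck 3 f ->
  injective delta ->
  0 < tau <= 1 ->
  0 < gamma0 < 1 ->
  bnqn_seq f delta tau gamma0 x ->
  ( (forall xs, critical f xs -> loj_at f xs) ->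
    (exists h : nat -> 'cV[R]_m, forall xs, critical f xs -> exists k, h k = xs) ->
    grad_loj f ->
    diverges x \/ exists2 xs, critical f xs & converges_to x xs )
  /\
  ( (forall xs, critical f xs -> loj_at f xs) ->
    (forall xs, critical f xs -> loj_exponent f xs * (1 + tau) < 1) ->
    (tau = 1 -> grad_loj f) ->
    diverges x \/ exists2 xs, critical f xs & converges_to x xs ).
Proof.
move=> f3 dinj tau01 gam01 xP; have f2 := Ck_leq f3.
have /andP[t0 t1] := tau01; have /andP[gam0 _] := gam01.
have crit xs : cluster_point x xs -> critical f xs.
  exact: (bnqn_cluster_critical f2 dinj t0 gam0 xP).
split=> [_ [h hcrit] floj|loj mutau _];
  (have [?|[xs clx]] := diverges_or_cluster x; first by left); right; exists xs;
  try exact: crit.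
- apply: (vanishing_steps_converge (h := h)) clx => [y /crit/hcrit//|y e /crit cy e0].
  have [r r0 hr] := bnqn_step_small f2 dinj tau01 gam01 cy floj e0.
  by exists r => // k kr; exact: hr kr (xP k).
have cxs := crit xs clx.
have lt : loj_exponent f xs < (1 + tau)^-1.
  by rewrite -[ltRHS]mul1r ltr_pdivlMr ?mutau// addr_gt0.
have [mu [r [C [mu0 mub r0 C0 hl]]]] := loj_exponent_witness (loj xs cxs) lt.
apply: (loj_cluster_converges f2 dinj t0 gam0 xP clx r0 mu0 C0) hl.
(* The exponent required is [mu (1 + tau / 2)], which lies below [mu (1 + tau)]. *)
have : mu * (1 + tau) < 1 by rewrite -ltr_pdivlMr ?addr_gt0// mul1r.
have : 0 < mu * tau by rewrite mulr_gt0.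
rewrite !mulrDr; lra.
Qed.
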